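(* Let $0<a\le 1$ and let $f(s)=\zeta(s,a)-a^{-s}$, where $\zeta(s,a)$ is the Hurwitz zeta function. Then the series $$T[f](s)=\sum_{n=0}^{\infty} p_n(s)\exp(nD)[f](s)$$ diverges for every $s\in\mathbb{C}$, in the following sense: for every $s\in\mathbb{C}$ there exists an integer $N\ge 0$ such that the $N$-th term $p_N(s)\exp(ND)[f](s)$ is not a well-defined complex number, because the series $\exp(ND)[f](s)$ is undefined (when $s=1$) or divergent. Consequently, the partial sums $\sum_{n=0}^{M}p_n(s)\exp(nD)[f](s)$ do not form a sequence of complex numbers for $M\ge N$.
   Context: $\zeta(s,a)$ denotes the Hurwitz zeta function. For $\operatorname{Re}(s)>1$ it is given by $\zeta(s,a)=\sum_{k\ge0}(k+a)^{-s}$, and it is continued meromorphically to $\mathbb{C}$ with a single simple pole at $s=1$. The coefficients are $p_0(s)=1$ and $p_n(s)=\frac{1}{(n+1)!}\prod_{j=0}^{n-1}(s+j)$ for $n>0$. For a function $f$ that is holomorphic near $s$ and an integer $n\ge0$, $\exp(nD)[f](s)$ denotes the series $f(s)+\sum_{k=1}^\infty \frac{n^k}{k!}f^{(k)}(s)$, where $f^{(k)}$ is the $k$-th derivative in $s$. The operator $T$ (Van Gorder's operator) is $T=\sum_{n\ge0}p_n(s)\exp(nD)$. *)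

(* Defs.v *)
(* Stdlib reals with Coquelicot's complex numbers [C]. *)
From Stdlib Require Import Reals Factorial.
From Coquelicot Require Import Coquelicot.
Open Scope C_scope.

Definition Cexp (z : C) : C := (exp (Re z) * cos (Im z), exp (Re z) * sin (Im z))%R.

(* x^s for a real base x > 0, with the real logarithm of x. *)
Definition Rcpow (x : R) (s : C) : C := Cexp (s * RtoC (ln x)).

(* Differentiability is over the field C: Coquelicot infers [K := C_AbsRing]. *)
Definition holomorphic_near (f : C -> C) (s : C) : Prop :=
  locally s (fun z : C => ex_derive f z).

Definition simple_pole (f : C -> C) (s0 : C) : Prop :=
  exists g : C -> C,
    holomorphic_near g s0 /\ g s0 <> 0 /\
    locally' s0 (fun z : C => f z = g z / (z - s0)).

(* [Z] is the function zeta(.,a). By the identity theorem this determines [Z] on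
   C minus {1}; the value [Z 1] is left arbitrary. *)
Record is_hurwitz_zeta (a : R) (Z : C -> C) : Prop := {
  hurwitz_series : forall s : C, (1 < Re s)%R ->
    is_series (fun k : nat => Rcpow (INR k + a) (- s)) (Z s);
  hurwitz_holomorphic : forall s : C, s <> 1 -> holomorphic_near Z s;
  hurwitz_pole : simple_pole Z 1
}.

(* [C_derive] is total; it is the complex derivative wherever that exists
   ([is_C_derive_unique]), hence at all orders wherever f is holomorphic nearby. *)
Fixpoint C_derive_n (f : C -> C) (k : nat) : C -> C :=
  match k with
  | O => f
  | S k' => C_derive (C_derive_n f k')
  end.

(* The term for k = 0 is f(s), also for n = 0, since [0 ^ 0 = 1]. *)
Definition expD_term (n : nat) (f : C -> C) (s : C) (k : nat) : C :=
  RtoC (INR n) ^ k / RtoC (INR (fact k)) * C_derive_n f k s.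

(* exp(nD)[f](s) is a well-defined complex number, equal to [v]. *)
Definition is_expD (n : nat) (f : C -> C) (s v : C) : Prop :=
  holomorphic_near f s /\ is_series (expD_term n f s) v.

Fixpoint rising (s : C) (n : nat) : C :=
  match n with
  | O => 1
  | S n' => rising s n' * (s + RtoC (INR n'))
  end.

(* The empty product gives p_0(s) = 1. *)
Definition p (n : nat) (s : C) : C := / RtoC (INR (fact (n + 1))) * rising s n.

(* The n-th term p_n(s) exp(nD)[f](s) of T[f](s) is a well-defined complex number,
   equal to [v]. A factor p_n(s) = 0 does not make an undefined exp(nD)[f](s)
   acceptable. *)
Definition is_T_term (f : C -> C) (s : C) (n : nat) (v : C) : Prop :=
  exists e : C, is_expD n f s e /\ v = p n s * e.

(* The partial sum over 0 <= n <= M is a well-defined complex number, equal to [v]. *)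
Definition is_T_partial_sum (f : C -> C) (s : C) (M : nat) (v : C) : Prop :=
  exists t : nat -> C,
    (forall n : nat, (n <= M)%nat -> is_T_term f s n (t n)) /\ v = sum_n t M.

(* Main.v *)
(* Since zeta(., a) has a simple pole at 1 and is holomorphic elsewhere, f(z) = A / (z - 1) + q(z)
   with A <> 0 and q entire. For N >= |s - 1| the k-th term of exp(ND)[f](s) is the sum of
   (-1)^k A (N / (s - 1))^k / (s - 1), whose modulus is bounded below, and of N^k q^(k)(s) / k!,
   which tends to 0 because q is entire; so the series diverges. At s = 1, f is not even
   differentiable.

   The Cauchy theory this needs rests on a single formula,
     2 PI f'(z) = integral over v in [0, 2 PI] of f(z + r e^(iv)) / (r e^(iv)),
   which follows from Goursat's lemma on rectangles applied to w |-> f(z + e^w) e^(-w). It gives the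
   Cauchy estimate for f', and, differentiated under the integral sign, the holomorphy of f'. *)

Require Import Defs.
From Stdlib Require Import Reals Lra Classical ClassicalEpsilon.
From Coquelicot Require Import Coquelicot.
Open Scope C_scope.

(** * Complex differentiability *)

(** Only functions differentiable on all of C are integrated, so no domain has to be tracked. The
    pole is removed algebraically: (z - 1) f(z), with its value at 1 corrected, is entire, and its
    difference quotient at 1 is q. Differentiability of q at 1 uses a second derivative there, and
    the Taylor terms of q use derivatives of every order. [entire] only asserts a first derivative,
    so the holomorphy of f' is the central step. A formula for f', rather than for f, has the
    advantage that its estimate can be iterated: k steps of size R/k bound |q^(k)(s)| by M (2k/R)^k,
    where M bounds |q| on the disc of radius R about s. Compared with the classical k! M / R^k this
    loses the factor 2^k k^k / k!, at most 6^k. Since q is entire, R may grow with N, and R = 12 N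
    bounds the k-th term of exp(ND)[q](s) by M / 2^k. *)

Lemma Cmod_eq_re_im (z : C) : Cmod z = sqrt (Re z ^ 2 + Im z ^ 2).
Proof. reflexivity. Qed.

Lemma Cmod_le_re_im (z : C) : (Cmod z <= Rabs (Re z) + Rabs (Im z))%R.
Proof.
  rewrite Cmod_eq_re_im.
  pose proof (Rabs_pos (Re z)). pose proof (Rabs_pos (Im z)).
  rewrite <- (sqrt_Rsqr (Rabs (Re z) + Rabs (Im z))) by lra.
  apply sqrt_le_1_alt. unfold Rsqr.
  rewrite <- (pow2_abs (Re z)), <- (pow2_abs (Im z)). nra.
Qed.

Lemma im_le_Cmod (z : C) : (Rabs (Im z) <= Cmod z)%R.
Proof. eapply Rle_trans; [apply Rmax_r | apply Rmax_Cmod]. Qed.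

Lemma Cmod_minus_sym (x y : C) : Cmod (x - y) = Cmod (y - x).
Proof. rewrite <- Cmod_opp. f_equal. ring. Qed.

(** An explicit epsilon-delta form, so that remainders can be estimated with [Cmod] directly instead
    of through filters. The weak inequality covers [w = 0]. *)
Definition Cdiff_at (f : C -> C) (z l : C) : Prop :=
  forall eps, (0 < eps)%R -> exists del, (0 < del)%R /\
    forall w, (Cmod w < del)%R -> (Cmod (f (z + w)%C - f z - l * w)%C <= eps * Cmod w)%R.

Lemma locally_C_Cmod (z : C) (P : C -> Prop) :
  locally (T := C_UniformSpace) z P <->
  exists del, (0 < del)%R /\ forall w, (Cmod (w - z) < del)%R -> P w.
Proof.
  rewrite locally_C. split.
  - intros [d Hd]. exists d. split; [apply cond_pos|]. intros w Hw. apply Hd. exact Hw.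
  - intros [d [H Hd]]. exists (mkposreal d H). intros w Hw. apply Hd. exact Hw.
Qed.

Lemma is_derive_Cdiff_at (f : C -> C) (z l : C) :
  is_derive (K := C_AbsRing) (V := C_NormedModule) f z l <-> Cdiff_at f z l.
Proof.
  split.
  - intros [_ H] eps Heps.
    specialize (H z (fun P HP => HP) (mkposreal eps Heps)).
    apply (proj2 (locally_C z _)), locally_C_Cmod in H. destruct H as [d [Hd H]].
    exists d. split; [exact Hd|]. intros w Hw.
    specialize (H (z + w)).
    replace (z + w - z) with w in H by ring. specialize (H Hw).
    replace (f (z + w) - f z - l * w)
      with (minus (minus (f (z + w)) (f z)) (scal (minus (z + w) z) l)).
    2:{ unfold minus, plus, opp, scal; simpl; unfold mult; simpl. ring. }
    replace w with (minus (z + w) z) at 3.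
    2:{ unfold minus, plus, opp; simpl. ring. }
    exact H.
  - intros H. split; [apply is_linear_scal_l|].
    intros x Hx eps.
    assert (E : z = x) by exact (is_filter_lim_locally_unique _ _ Hx). subst x.
    destruct (H eps (cond_pos eps)) as [d [Hd H']].
    apply (proj1 (locally_C z _)), locally_C_Cmod.
    exists d. split; [exact Hd|]. intros y Hy.
    specialize (H' (y - z) Hy). replace (z + (y - z)) with y in H' by ring.
    rewrite (Cmult_comm l) in H'.
    exact H'.
Qed.

Lemma Cdiff_at_C_derive (f : C -> C) (z l : C) : Cdiff_at f z l -> C_derive f z = l.
Proof. intros H. apply is_C_derive_unique, is_derive_Cdiff_at, H. Qed.

Lemma ex_derive_Cdiff_at (f : C -> C) (z : C) :
  ex_derive (K := C_AbsRing) (V := C_NormedModule) f z <-> exists l, Cdiff_at f z l.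
Proof.
  split; intros [l H]; exists l; apply is_derive_Cdiff_at; exact H.
Qed.

(** The hypothesis [l = d] lets a derivative be assembled by the differentiation rules and brought
    to the desired form by [ring] or [field] afterwards. *)
Lemma Cdiff_at_ext_loc (f g : C -> C) (z l d : C) (r : R) : (0 < r)%R ->
  (forall w, (Cmod (w - z) < r)%R -> f w = g w) -> l = d -> Cdiff_at f z l -> Cdiff_at g z d.
Proof.
  intros Hr E <- H eps Heps. destruct (H eps Heps) as [del [Hd H']].
  exists (Rmin r del). split; [apply Rmin_pos; assumption|].
  intros w Hw. rewrite <- !E.
  - apply H'. eapply Rlt_le_trans; [exact Hw|apply Rmin_r].
  - replace (z - z) with (RtoC 0) by ring. rewrite Cmod_0. exact Hr.
  - replace (z + w - z) with w by ring. eapply Rlt_le_trans; [exact Hw|apply Rmin_l].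
Qed.

Lemma Cdiff_at_ext (f g : C -> C) (z l d : C) :
  (forall w, f w = g w) -> l = d -> Cdiff_at f z l -> Cdiff_at g z d.
Proof. intros E. apply (Cdiff_at_ext_loc f g z l d 1 Rlt_0_1). auto. Qed.

Lemma Cdiff_at_const (c z : C) : Cdiff_at (fun _ => c) z 0.
Proof. apply is_derive_Cdiff_at.
  exact (is_derive_const (K := C_AbsRing) (V := C_NormedModule) c z). Qed.

Lemma Cdiff_at_id (z : C) : Cdiff_at (fun w => w) z 1.
Proof.
  intros eps Heps. exists 1%R. split; [lra|]. intros w _.
  replace (z + w - z - 1 * w) with (RtoC 0) by ring. rewrite Cmod_0.
  pose proof (Cmod_ge_0 w). nra.
Qed.

Lemma Cdiff_at_plus (f g : C -> C) (z l m : C) :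
  Cdiff_at f z l -> Cdiff_at g z m -> Cdiff_at (fun w => f w + g w) z (l + m).
Proof. intros H1%is_derive_Cdiff_at H2%is_derive_Cdiff_at.
  apply is_derive_Cdiff_at. exact (is_derive_plus _ _ _ _ _ H1 H2).
Qed.

Lemma Cdiff_at_minus (f g : C -> C) (z l m : C) :
  Cdiff_at f z l -> Cdiff_at g z m -> Cdiff_at (fun w => f w - g w) z (l - m).
Proof. intros H1%is_derive_Cdiff_at H2%is_derive_Cdiff_at.
  apply is_derive_Cdiff_at. exact (is_derive_minus _ _ _ _ _ H1 H2).
Qed.

Lemma Cdiff_at_continuous (f : C -> C) (z l : C) : Cdiff_at f z l ->
  forall eps, (0 < eps)%R -> exists del, (0 < del)%R /\
    forall w, (Cmod (w - z) < del)%R -> (Cmod (f w - f z) < eps)%R.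
Proof.
  intros H eps Heps. destruct (H 1%R Rlt_0_1) as [d [Hd H']].
  pose proof (Cmod_ge_0 l).
  exists (Rmin d (eps / (2 + Cmod l))). split.
  - apply Rmin_pos; [exact Hd|]. apply Rdiv_lt_0_compat; lra.
  - intros w Hw. specialize (H' (w - z)).
    replace (z + (w - z)) with w in H' by ring.
    assert (W1 : (Cmod (w - z) < d)%R) by (eapply Rlt_le_trans; [exact Hw|apply Rmin_l]).
    assert (W2 : (Cmod (w - z) < eps / (2 + Cmod l))%R) by (eapply Rlt_le_trans; [exact Hw|apply Rmin_r]).
    specialize (H' W1).
    replace (f w - f z) with ((f w - f z - l * (w - z)) + l * (w - z)) by ring.
    eapply Rle_lt_trans; [apply Cmod_triangle|]. rewrite Cmod_mult.
    apply Rmult_lt_compat_r with (r := (2 + Cmod l)%R) in W2; [|lra].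
    unfold Rdiv in W2. rewrite Rmult_assoc, Rinv_l, Rmult_1_r in W2 by lra.
    pose proof (Cmod_ge_0 (w - z)). nra.
Qed.

(** Supplies a tolerance [e] such that both [e] and [e * A] are at most [eps / k]; the summand 1
    avoids a separate case [A = 0]. *)
Lemma pos_div_succ (eps k A : R) : (0 < eps)%R -> (0 < k)%R -> (0 <= A)%R ->
  exists e, (0 < e)%R /\ (k * (e * (1 + A)) <= eps)%R.
Proof.
  intros. exists (eps / (k * (1 + A)))%R. split.
  - apply Rdiv_lt_0_compat; nra.
  - right. field. lra.
Qed.

Lemma Cdiff_at_mult (f g : C -> C) (z l m : C) :
  Cdiff_at f z l -> Cdiff_at g z m -> Cdiff_at (fun w => f w * g w) z (l * g z + f z * m).
Proof.
  intros Hf Hg eps Heps.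
  destruct (pos_div_succ eps 3 (Cmod (g z)) Heps ltac:(lra) (Cmod_ge_0 _)) as [e1 [P1 E1]].
  destruct (pos_div_succ eps 3 (Cmod (f z)) Heps ltac:(lra) (Cmod_ge_0 _)) as [e2 [P2 E2]].
  destruct (pos_div_succ eps 3 (Cmod l) Heps ltac:(lra) (Cmod_ge_0 _)) as [e3 [P3 E3]].
  destruct (Hf e1 P1) as [d1 [D1 A1]]. destruct (Hg e2 P2) as [d2 [D2 A2]].
  (* The bound 1 keeps [g (z + w)] below [1 + Cmod (g z)]; the bound [e3] makes the cross term
     [l * w * (g (z + w) - g z)] small. *)
  destruct (Cdiff_at_continuous g z m Hg (Rmin 1 e3)) as [d3 [D3 A3]]; [apply Rmin_pos; lra|].
  exists (Rmin d1 (Rmin d2 d3)). split; [repeat apply Rmin_pos; assumption|].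
  intros w Hw. apply Rmin_Rgt_l in Hw as [H1 Hw]. apply Rmin_Rgt_l in Hw as [H2 H3].
  specialize (A1 w H1). specialize (A2 w H2). specialize (A3 (z + w)).
  replace (z + w - z) with w in A3 by ring. specialize (A3 H3).
  apply Rmin_Rgt_l in A3 as [A3 A4].
  replace (f (z + w) * g (z + w) - f z * g z - (l * g z + f z * m) * w)
    with ((f (z + w) - f z - l * w) * g (z + w) + f z * (g (z + w) - g z - m * w)
          + l * w * (g (z + w) - g z)) by ring.
  eapply Rle_trans; [apply Cmod_triangle|].
  eapply Rle_trans; [apply Rplus_le_compat_r, Cmod_triangle|].
  rewrite !Cmod_mult.
  assert (G : (Cmod (g (z + w)%C) <= 1 + Cmod (g z))%R).
  { replace (g (z + w)) with ((g (z + w) - g z) + g z) by ring.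
    eapply Rle_trans; [apply Cmod_triangle|]. lra. }
  pose proof (Cmod_ge_0 w). pose proof (Cmod_ge_0 (g (z + w))). pose proof (Cmod_ge_0 l).
  pose proof (Cmod_ge_0 (f z)). pose proof (Cmod_ge_0 (g z)).
  set (x := Cmod w) in *. set (gw := Cmod (g (z + w))) in *.
  assert (B1 : (Cmod (f (z + w)%C - f z - l * w)%C * gw <= eps / 3 * x)%R).
  { eapply Rle_trans; [apply Rmult_le_compat; [apply Cmod_ge_0|assumption|exact A1|exact G]|]. nra. }
  assert (B2 : (Cmod (f z) * Cmod (g (z + w)%C - g z - m * w)%C <= eps / 3 * x)%R).
  { eapply Rle_trans; [apply Rmult_le_compat_l; [assumption|exact A2]|].
    assert (Cmod (f z) * e2 <= eps / 3)%R by nra. nra. }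
  assert (B3 : (Cmod l * x * Cmod (g (z + w)%C - g z)%C <= eps / 3 * x)%R).
  { eapply Rle_trans; [apply Rmult_le_compat_l; [nra|left; exact A4]|].
    assert (Cmod l * e3 <= eps / 3)%R by nra. nra. }
  lra.
Qed.

Lemma Cdiff_at_comp (f g : C -> C) (z l m : C) :
  Cdiff_at f (g z) l -> Cdiff_at g z m -> Cdiff_at (fun w => f (g w)) z (l * m).
Proof.
  intros Hf Hg eps Heps.
  destruct (pos_div_succ eps 2 (Cmod m) Heps ltac:(lra) (Cmod_ge_0 _)) as [e1 [P1 E1]].
  destruct (pos_div_succ eps 2 (Cmod l) Heps ltac:(lra) (Cmod_ge_0 _)) as [e2 [P2 E2]].
  destruct (Hf e1 P1) as [d1 [D1 A1]].
  destruct (Hg (Rmin 1 e2)) as [d2 [D2 A2]]; [apply Rmin_pos; lra|].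
  destruct (Cdiff_at_continuous g z m Hg d1 D1) as [d3 [D3 A3]].
  exists (Rmin d2 d3). split; [repeat apply Rmin_pos; assumption|].
  intros w Hw. apply Rmin_Rgt_l in Hw as [H2 H3].
  specialize (A2 w H2). specialize (A3 (z + w)).
  replace (z + w - z) with w in A3 by ring. specialize (A3 H3).
  specialize (A1 _ A3).
  set (v := g (z + w) - g z) in *.
  replace (g z + v) with (g (z + w)) in A1 by (unfold v; ring).
  replace (f (g (z + w)) - f (g z) - l * m * w)
    with ((f (g (z + w)) - f (g z) - l * v) + l * (v - m * w)) by ring.
  eapply Rle_trans; [apply Cmod_triangle|]. rewrite Cmod_mult.
  pose proof (Cmod_ge_0 w). pose proof (Cmod_ge_0 l). pose proof (Cmod_ge_0 m).
  set (x := Cmod w) in *.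
  assert (B1 : (Cmod (v - m * w)%C <= x)%R).
  { eapply Rle_trans; [exact A2|]. pose proof (Rmin_l 1 e2). nra. }
  assert (B2 : (Cmod (v - m * w)%C <= e2 * x)%R).
  { eapply Rle_trans; [exact A2|]. pose proof (Rmin_r 1 e2). nra. }
  assert (B3 : (Cmod v <= (1 + Cmod m) * x)%R).
  { replace v with ((v - m * w) + m * w) by ring.
    eapply Rle_trans; [apply Cmod_triangle|]. rewrite Cmod_mult. fold x. lra. }
  assert (B4 : (e1 * Cmod v <= eps / 2 * x)%R).
  { eapply Rle_trans; [apply Rmult_le_compat_l; [lra|exact B3]|]. nra. }
  assert (B5 : (Cmod l * Cmod (v - m * w)%C <= eps / 2 * x)%R).
  { eapply Rle_trans; [apply Rmult_le_compat_l; [assumption|exact B2]|].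
    assert (Cmod l * e2 <= eps / 2)%R by nra. nra. }
  lra.
Qed.

Lemma Cdiff_at_inv (z : C) : z <> 0 -> Cdiff_at (fun w => / w) z (- / (z * z)).
Proof.
  intros Hz eps Heps.
  assert (Z : (0 < Cmod z)%R) by (apply Cmod_gt_0; exact Hz).
  set (A := Cmod z) in *.
  (* The remainder is w^2 / ((z + w) z^2). The first radius gives |z + w| > A / 2; the second then
     makes 2 |w| / A^3 less than [eps]. *)
  exists (Rmin (A / 2) (eps * A * A * A / 2))%R. split.
  - apply Rmin_pos; [lra|]. repeat apply Rmult_lt_0_compat; lra.
  - intros w Hw.
    assert (W1 : (Cmod w < A / 2)%R) by (eapply Rlt_le_trans; [exact Hw|apply Rmin_l]).
    assert (W2 : (Cmod w < eps * A * A * A / 2)%R) by (eapply Rlt_le_trans; [exact Hw|apply Rmin_r]).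
    assert (T : (A / 2 < Cmod (z + w))%R).
    { assert (A <= Cmod (z + w) + Cmod w)%R; [|lra].
      unfold A. replace z with ((z + w) + - w) at 1 by ring.
      rewrite <- (Cmod_opp w). apply Cmod_triangle. }
    assert (N : z + w <> 0) by (apply Cmod_gt_0; lra).
    replace (/ (z + w) - / z - - / (z * z) * w) with (w * (w * / (z + w) * / (z * z))).
    2:{ field. auto. }
    rewrite Rmult_comm. rewrite Cmod_mult. apply Rmult_le_compat_l; [apply Cmod_ge_0|].
    rewrite !Cmod_mult, !Cmod_inv, Cmod_mult; auto. 2:{ apply Cmult_neq_0; auto. }
    fold A.
    apply Rle_trans with (Cmod w * / (A / 2) * / (A * A))%R.
    + apply Rmult_le_compat_r; [apply Rlt_le, Rinv_0_lt_compat; nra|].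
      apply Rmult_le_compat_l; [apply Cmod_ge_0|].
      apply Rinv_le_contravar; lra.
    + apply Rmult_le_reg_r with (A * A * A / 2)%R.
      * repeat apply Rmult_lt_0_compat; lra.
      * replace (Cmod w * / (A / 2) * / (A * A) * (A * A * A / 2))%R with (Cmod w) by (field; lra).
        lra.
Qed.

Lemma Cmod_triangle_minus (x y : C) : (Cmod (x - y) <= Cmod x + Cmod y)%R.
Proof. rewrite <- (Cmod_opp y). apply Cmod_triangle. Qed.

(** * The complex exponential function *)

Lemma Cexp_add (z w : C) : Cexp (z + w) = Cexp z * Cexp w.
Proof.
  destruct z as [a b], w as [c d]. unfold Cexp, Re, Im, Cmult, Cplus; simpl.
  rewrite exp_plus, cos_plus, sin_plus. f_equal; ring.
Qed.

Lemma Cexp_0 : Cexp 0 = 1.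
Proof. unfold Cexp, Re, Im; simpl. rewrite exp_0, cos_0, sin_0. unfold RtoC. f_equal; ring. Qed.

Lemma Cmod_Cexp (z : C) : Cmod (Cexp z) = exp (Re z).
Proof.
  rewrite Cmod_eq_re_im. unfold Cexp; simpl Re; simpl Im.
  replace ((exp (Re z) * cos (Im z)) ^ 2 + (exp (Re z) * sin (Im z)) ^ 2)%R
    with (Rsqr (exp (Re z)) * (Rsqr (sin (Im z)) + Rsqr (cos (Im z))))%R by (unfold Rsqr; ring).
  rewrite sin2_cos2, Rmult_1_r. apply sqrt_Rsqr. left. apply exp_pos.
Qed.

Lemma is_derive_R_linear_approx (f : R -> R) (l : R) : is_derive f 0 l ->
  forall eps, (0 < eps)%R -> exists del, (0 < del)%R /\
    forall x, (Rabs x < del)%R -> (Rabs (f x - f 0 - l * x) <= eps * Rabs x)%R.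
Proof.
  intros [_ H] eps Heps.
  specialize (H 0%R (fun P HP => HP) (mkposreal eps Heps)). destruct H as [d H].
  exists d. split; [apply cond_pos|]. intros x Hx. specialize (H x).
  assert (B : ball 0%R d x).
  { unfold ball; simpl; unfold AbsRing_ball, abs, minus, plus, opp; simpl.
    rewrite Ropp_0, Rplus_0_r. exact Hx. }
  specialize (H B). unfold norm, minus, plus, opp, scal in H; simpl in H.
  unfold abs, mult in H; simpl in H.
  replace (f x - f 0 - l * x)%R with (f x + - f 0 + - ((x + - 0) * l))%R by ring.
  replace (x + - 0)%R with x in * by ring. exact H.
Qed.

Lemma Cdiff_at_Cexp_0 : Cdiff_at Cexp 0 1.
Proof.
  intros eps Heps.
  (* The real and imaginary parts of the remainder are bounded below by 4 and 5 times [e * m],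
     whence 9. The cap 1 bounds the factor [1 + x + u] by 3. *)
  set (e := Rmin (eps / 9) 1). assert (He : (0 < e)%R) by (apply Rmin_pos; lra).
  assert (He1 : (e <= 1)%R) by apply Rmin_r.
  assert (He8 : (e <= eps / 9)%R) by apply Rmin_l.
  assert (D1 : is_derive exp 0%R 1%R) by (auto_derive; [auto|rewrite exp_0; ring]).
  assert (D2 : is_derive cos 0%R 0%R) by (auto_derive; [auto|rewrite sin_0; ring]).
  assert (D3 : is_derive sin 0%R 1%R) by (auto_derive; [auto|rewrite cos_0; ring]).
  destruct (is_derive_R_linear_approx _ _ D1 e He) as [d1 [P1 A1]].
  destruct (is_derive_R_linear_approx _ _ D2 e He) as [d2 [P2 A2]].
  destruct (is_derive_R_linear_approx _ _ D3 e He) as [d3 [P3 A3]].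
  exists (Rmin e (Rmin d1 (Rmin d2 d3))). split; [clearbody e; repeat apply Rmin_pos; assumption|].
  intros w Hw. rewrite Cplus_0_l, Cexp_0.
  apply Rmin_Rgt_l in Hw as [H0 Hw]. apply Rmin_Rgt_l in Hw as [H1 Hw].
  apply Rmin_Rgt_l in Hw as [H2 H3].
  pose proof (re_le_Cmod w) as Rw. pose proof (im_le_Cmod w) as Iw.
  set (x := Re w) in *. set (y := Im w) in *.
  specialize (A1 x ltac:(lra)). specialize (A2 y ltac:(lra)). specialize (A3 y ltac:(lra)).
  rewrite exp_0 in A1. rewrite cos_0 in A2. rewrite sin_0 in A3.
  (* The remainder of [Cexp] is expressed through the first-order remainders of [exp], [cos] and
     [sin], named [u], [v], [t] below. *)
  assert (E : Cexp w - 1 - 1 * w =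
    ((exp x - 1 - 1 * x) + (1 + x + (exp x - 1 - 1 * x)) * (cos y - 1 - 0 * y),
     (sin y - 0 - 1 * y) + (x + (exp x - 1 - 1 * x)) * (y + (sin y - 0 - 1 * y)))%R).
  { unfold Cexp, Cminus, Cplus, Copp, Cmult, RtoC; simpl. subst x y. destruct w as [a b]; simpl.
    f_equal; ring. }
  rewrite E. eapply Rle_trans; [apply Cmod_le_re_im|]. simpl.
  set (m := Cmod w) in *.
  assert (M : (0 <= m)%R) by apply Cmod_ge_0.
  set (u := (exp x - 1 - 1 * x)%R) in *. set (v := (cos y - 1 - 0 * y)%R) in *.
  set (t := (sin y - 0 - 1 * y)%R) in *.
  assert (U : (Rabs u <= e * m)%R) by nra.
  assert (V : (Rabs v <= e * m)%R) by nra.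
  assert (T : (Rabs t <= e * m)%R) by nra.
  assert (EM : (e * m <= 1)%R) by nra.
  assert (B1 : (Rabs (u + (1 + x + u) * v) <= e * m + 3 * (e * m))%R).
  { eapply Rle_trans; [apply Rabs_triang|]. rewrite Rabs_mult.
    assert (Rabs (1 + x + u) <= 3)%R.
    { eapply Rle_trans; [apply Rabs_triang|].
      pose proof (Rabs_triang 1 x). rewrite Rabs_R1 in *. lra. }
    pose proof (Rabs_pos v). nra. }
  assert (B2 : (Rabs (t + (x + u) * (y + t)) <= e * m + 4 * (e * m))%R).
  { eapply Rle_trans; [apply Rabs_triang|]. rewrite Rabs_mult.
    assert (X : (Rabs (x + u) <= 2 * e)%R).
    { eapply Rle_trans; [apply Rabs_triang|]. nra. }
    assert (Y : (Rabs (y + t) <= 2 * m)%R).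
    { eapply Rle_trans; [apply Rabs_triang|]. nra. }
    pose proof (Rabs_pos (x + u)). pose proof (Rabs_pos (y + t)). nra. }
  nra.
Qed.

(** The addition theorem moves the point of differentiation to 0. *)
Lemma Cdiff_at_Cexp (z : C) : Cdiff_at Cexp z (Cexp z).
Proof.
  eapply Cdiff_at_ext with (f := fun w => Cexp z * Cexp (w - z)).
  3:{ apply Cdiff_at_mult; [apply Cdiff_at_const|].
      apply (Cdiff_at_comp Cexp (fun w => w - z) z 1).
      - replace (z - z) with (RtoC 0) by ring. apply Cdiff_at_Cexp_0.
      - apply Cdiff_at_minus; [apply Cdiff_at_id|apply Cdiff_at_const]. }
  - intros w. rewrite <- Cexp_add. f_equal. ring.
  - cbn beta. ring.
Qed.

(** * Bisection and integrals of complex-valued functions *)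

(** Every left endpoint lies below every right endpoint, so the supremum of the left endpoints
    serves as [c]. *)
Lemma nested_intervals (u l : nat -> R) :
  (forall n, (u n <= u (S n))%R) -> (forall n, (u (S n) + l (S n) <= u n + l n)%R) ->
  (forall n, (0 <= l n)%R) -> exists c, forall n, (u n <= c <= u n + l n)%R.
Proof.
  intros Hu Hl H0.
  assert (U : forall n k, (u n <= u (n + k)%nat)%R).
  { intros n k. induction k as [|k IH].
    - rewrite Nat.add_0_r. lra.
    - rewrite Nat.add_succ_r. specialize (Hu (n + k)%nat). lra. }
  assert (L : forall n k, (u (n + k)%nat + l (n + k)%nat <= u n + l n)%R).
  { intros n k. induction k as [|k IH].
    - rewrite Nat.add_0_r. lra.
    - rewrite Nat.add_succ_r. specialize (Hl (n + k)%nat). lra. }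
  assert (B : forall m n, (u m <= u n + l n)%R).
  { intros m n. specialize (U m n). specialize (L n m). rewrite Nat.add_comm in L.
    specialize (H0 (m + n)%nat). lra. }
  destruct (completeness (fun x => exists n, x = u n)) as [c [Hc1 Hc2]].
  - exists (u 0%nat + l 0%nat)%R. intros x [n ->]. apply B.
  - exists (u 0%nat). exists 0%nat. reflexivity.
  - exists c. intros n. split.
    + apply Hc1. exists n. reflexivity.
    + apply Hc2. intros x [m ->]. apply B.
Qed.

(* The arguments of [P] are the lower left corner and the side lengths of a rectangle. *)
Lemma rectangle_bisection (P : R -> R -> R -> R -> Prop) :
  (forall x y a b, (0 <= a)%R -> (0 <= b)%R ->
     P x y (a / 2)%R (b / 2)%R -> P (x + a / 2)%R y (a / 2)%R (b / 2)%R ->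
     P x (y + b / 2)%R (a / 2)%R (b / 2)%R -> P (x + a / 2)%R (y + b / 2)%R (a / 2)%R (b / 2)%R ->
     P x y a b) ->
  (forall c d, exists del, (0 < del)%R /\ forall x y a b,
     (0 <= a < del)%R -> (0 <= b < del)%R -> (x <= c <= x + a)%R -> (y <= d <= y + b)%R ->
     P x y a b) ->
  forall x y a b, (0 <= a)%R -> (0 <= b)%R -> P x y a b.
Proof.
  intros Hsub Hloc x y a b Ha Hb. apply NNPP. intros HP.
  set (la := fun n => (a * (/ 2) ^ n)%R). set (lb := fun n => (b * (/ 2) ^ n)%R).
  assert (La : forall n, (0 <= la n)%R) by (intros n; apply Rmult_le_pos; [|apply pow_le]; lra).
  assert (Lb : forall n, (0 <= lb n)%R) by (intros n; apply Rmult_le_pos; [|apply pow_le]; lra).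
  assert (Sa : forall n, la (S n) = (la n / 2)%R) by (intros n; unfold la; simpl; field).
  assert (Sb : forall n, lb (S n) = (lb n / 2)%R) by (intros n; unfold lb; simpl; field).
  assert (Hstep : forall n (c : R * R), ~ P (fst c) (snd c) (la n) (lb n) ->
    exists c' : R * R, ~ P (fst c') (snd c') (la (S n)) (lb (S n)) /\
      (fst c <= fst c')%R /\ (fst c' + la (S n) <= fst c + la n)%R /\
      (snd c <= snd c')%R /\ (snd c' + lb (S n) <= snd c + lb n)%R).
  { intros n [c d] Hc; simpl in *. rewrite Sa, Sb.
    specialize (La n). specialize (Lb n).
    destruct (classic (P c d (la n / 2)%R (lb n / 2)%R)) as [Q1|Q1].
    2:{ exists (c, d); simpl. split; [exact Q1|]. lra. }
    destruct (classic (P (c + la n / 2)%R d (la n / 2)%R (lb n / 2)%R)) as [Q2|Q2].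
    2:{ exists (c + la n / 2, d)%R; simpl. split; [exact Q2|]. lra. }
    destruct (classic (P c (d + lb n / 2)%R (la n / 2)%R (lb n / 2)%R)) as [Q3|Q3].
    2:{ exists (c, d + lb n / 2)%R; simpl. split; [exact Q3|]. lra. }
    destruct (classic (P (c + la n / 2)%R (d + lb n / 2)%R (la n / 2)%R (lb n / 2)%R)) as [Q4|Q4].
    2:{ exists (c + la n / 2, d + lb n / 2)%R; simpl. split; [exact Q4|]. lra. }
    exfalso. apply Hc. apply Hsub; auto. }
  assert (H0 : ~ P (fst (x, y)) (snd (x, y)) (la 0%nat) (lb 0%nat)).
  { unfold la, lb; simpl. rewrite !Rmult_1_r. exact HP. }
  (* Dependent choice: each rectangle is stored with the proof that it violates [P], which is what
     the choice of a bad quarter requires. *)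
  set (seq := fix seq (n : nat) : {c : R * R | ~ P (fst c) (snd c) (la n) (lb n)} :=
    match n with
    | O => exist _ (x, y) H0
    | S m =>
        let s := constructive_indefinite_description _
                   (Hstep m (proj1_sig (seq m)) (proj2_sig (seq m))) in
        exist _ (proj1_sig s) (proj1 (proj2_sig s))
    end).
  set (c := fun n => proj1_sig (seq n)).
  assert (Hc : forall n, (fst (c n) <= fst (c (S n)))%R /\
      (fst (c (S n)) + la (S n) <= fst (c n) + la n)%R /\
      (snd (c n) <= snd (c (S n)))%R /\ (snd (c (S n)) + lb (S n) <= snd (c n) + lb n)%R).
  { intros n. unfold c. simpl.
    destruct (constructive_indefinite_description _ _) as [c' Hc']. simpl. apply Hc'. }
  destruct (nested_intervals (fun n => fst (c n)) la) as [p Hp]; try apply Hc; auto.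
  destruct (nested_intervals (fun n => snd (c n)) lb) as [q Hq]; try apply Hc; auto.
  destruct (Hloc p q) as [del [Hdel Hl]].
  (* After [n] halvings both sides are shorter than [del]; the 1 in the denominator covers
     [a = b = 0]. *)
  destruct (pow_lt_1_zero (/ 2) ltac:(rewrite Rabs_pos_eq; lra) (del / (a + b + 1))%R) as [n Hn].
  { apply Rdiv_lt_0_compat; lra. }
  specialize (Hn n (Nat.le_refl n)).
  assert (E : (0 <= (/ 2) ^ n)%R) by (apply pow_le; lra).
  rewrite Rabs_pos_eq in Hn by exact E.
  apply Rmult_lt_compat_r with (r := (a + b + 1)%R) in Hn; [|lra].
  unfold Rdiv in Hn. rewrite Rmult_assoc, Rinv_l, Rmult_1_r in Hn by lra.
  apply (proj2_sig (seq n)). fold (c n). apply Hl; auto.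
  - split; [apply La|]. unfold la. nra.
  - split; [apply Lb|]. unfold lb. nra.
Qed.

(** * Continuous complex-valued curves and their integrals *)

Definition Ccont_at (f : C -> C) (z : C) : Prop :=
  forall eps, (0 < eps)%R -> exists del, (0 < del)%R /\
    forall w, (Cmod (w - z) < del)%R -> (Cmod (f w - f z) < eps)%R.

(** Stated by components because [CInt] integrates them separately, and on the whole line so that
    integrability holds on every interval. *)
Definition Ccurve (g : R -> C) : Prop :=
  forall t, continuous (fun u => Re (g u)) t /\ continuous (fun u => Im (g u)) t.

Lemma continuous_R_eps (f : R -> R) (t : R) : continuous f t <->
  forall eps, (0 < eps)%R -> exists del, (0 < del)%R /\
    forall u, (Rabs (u - t) < del)%R -> (Rabs (f u - f t) < eps)%R.
Proof.
  unfold continuous. rewrite filterlim_locally. split.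
  - intros H eps Heps. destruct (H (mkposreal eps Heps)) as [d Hd].
    exists d. split; [apply cond_pos|]. intros u Hu. apply Hd. exact Hu.
  - intros H eps. destruct (H eps (cond_pos eps)) as [d [Hd H']].
    exists (mkposreal d Hd). intros u Hu. apply H'. exact Hu.
Qed.

Lemma Ccurve_eps (g : R -> C) : Ccurve g <->
  forall t eps, (0 < eps)%R -> exists del, (0 < del)%R /\
    forall u, (Rabs (u - t) < del)%R -> (Cmod (g u - g t) < eps)%R.
Proof.
  split.
  - intros H t eps Heps. destruct (H t) as [H1 H2].
    rewrite continuous_R_eps in H1, H2.
    destruct (H1 (eps / 2)%R ltac:(lra)) as [d1 [P1 A1]].
    destruct (H2 (eps / 2)%R ltac:(lra)) as [d2 [P2 A2]].
    exists (Rmin d1 d2). split; [apply Rmin_pos; assumption|].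
    intros u Hu. apply Rmin_Rgt_l in Hu as [U1 U2].
    specialize (A1 u U1). specialize (A2 u U2).
    eapply Rle_lt_trans; [apply Cmod_le_re_im|]. simpl. unfold Rminus in *.
    unfold Re, Im in *. lra.
  - intros H t. split; apply continuous_R_eps; intros eps Heps;
      destruct (H t eps Heps) as [d [P A]]; exists d; split; auto; intros u Hu;
      specialize (A u Hu); eapply Rle_lt_trans; try exact A.
    + exact (re_le_Cmod (g u - g t)).
    + exact (im_le_Cmod (g u - g t)).
Qed.

Lemma Ccurve_comp (f : C -> C) (g : R -> C) :
  Ccurve g -> (forall t, Ccont_at f (g t)) -> Ccurve (fun t => f (g t)).
Proof.
  rewrite !Ccurve_eps. intros Hg Hf t eps Heps.
  destruct (Hf t eps Heps) as [d [P A]]. destruct (Hg t d P) as [d' [P' A']].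
  exists d'. split; [exact P'|]. intros u Hu. apply A, A', Hu.
Qed.

Lemma Ccurve_ext (f g : R -> C) : (forall t, f t = g t) -> Ccurve f -> Ccurve g.
Proof.
  rewrite !Ccurve_eps. intros E H t eps Heps. destruct (H t eps Heps) as [d [P A]].
  exists d. split; [exact P|]. intros u Hu. rewrite <- !E. auto.
Qed.

Lemma Ccurve_const (c : C) : Ccurve (fun _ => c).
Proof. intros t. split; apply continuous_const. Qed.

Lemma Ccurve_plus (f g : R -> C) : Ccurve f -> Ccurve g -> Ccurve (fun t => f t + g t).
Proof.
  intros Hf Hg t. destruct (Hf t), (Hg t). split.
  - apply (continuous_plus (fun u => Re (f u)) (fun u => Re (g u))); assumption.
  - apply (continuous_plus (fun u => Im (f u)) (fun u => Im (g u))); assumption.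
Qed.

Lemma Ccurve_mult (f g : R -> C) : Ccurve f -> Ccurve g -> Ccurve (fun t => f t * g t).
Proof.
  intros Hf Hg t. destruct (Hf t), (Hg t). split.
  - apply (continuous_minus (fun u => Re (f u) * Re (g u))%R (fun u => Im (f u) * Im (g u))%R);
      apply (continuous_mult (K := R_AbsRing)); assumption.
  - apply (continuous_plus (fun u => Re (f u) * Im (g u))%R (fun u => Im (f u) * Re (g u))%R);
      apply (continuous_mult (K := R_AbsRing)); assumption.
Qed.

Lemma Ccurve_minus (f g : R -> C) : Ccurve f -> Ccurve g -> Ccurve (fun t => f t - g t).
Proof.
  intros Hf Hg. apply (Ccurve_ext (fun t => f t + (-(1)) * g t)).
  - intros t. ring.
  - apply Ccurve_plus; [exact Hf|]. apply Ccurve_mult; [apply Ccurve_const|exact Hg].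
Qed.

Lemma Ccurve_RtoC : Ccurve RtoC.
Proof. intros t. split; [apply continuous_id|apply continuous_const]. Qed.

Lemma Ccurve_line (c d : C) : Ccurve (fun t => c + RtoC t * d).
Proof.
  apply Ccurve_plus; [apply Ccurve_const|].
  apply Ccurve_mult; [apply Ccurve_RtoC|apply Ccurve_const].
Qed.

Definition CInt (g : R -> C) (a b : R) : C :=
  (RInt (fun t => Re (g t)) a b, RInt (fun t => Im (g t)) a b).

Lemma Ccurve_ex_RInt (g : R -> C) (a b : R) : Ccurve g ->
  ex_RInt (fun t => Re (g t)) a b /\ ex_RInt (fun t => Im (g t)) a b.
Proof.
  intros H. split; apply (ex_RInt_continuous (V := R_CompleteNormedModule)); intros t _; apply H.
Qed.

Lemma CInt_ext (f g : R -> C) (a b : R) : (forall t, f t = g t) -> CInt f a b = CInt g a b.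
Proof. intros E. unfold CInt. f_equal; apply RInt_ext; intros t _; rewrite E; reflexivity. Qed.

Lemma CInt_Chasles (f : R -> C) (a b c : R) :
  Ccurve f -> CInt f a b + CInt f b c = CInt f a c.
Proof.
  intros H. destruct (Ccurve_ex_RInt f a b H), (Ccurve_ex_RInt f b c H).
  unfold CInt, Cplus; simpl. f_equal.
  - exact (RInt_Chasles (fun t => Re (f t)) a b c ltac:(assumption) ltac:(assumption)).
  - exact (RInt_Chasles (fun t => Im (f t)) a b c ltac:(assumption) ltac:(assumption)).
Qed.

Lemma CInt_plus (f g : R -> C) (a b : R) : Ccurve f -> Ccurve g ->
  CInt (fun t => f t + g t) a b = CInt f a b + CInt g a b.
Proof.
  intros Hf Hg. destruct (Ccurve_ex_RInt f a b Hf), (Ccurve_ex_RInt g a b Hg).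
  unfold CInt, Cplus; simpl. f_equal.
  - exact (RInt_plus (fun t => Re (f t)) (fun t => Re (g t)) a b ltac:(assumption) ltac:(assumption)).
  - exact (RInt_plus (fun t => Im (f t)) (fun t => Im (g t)) a b ltac:(assumption) ltac:(assumption)).
Qed.

Lemma CInt_scal (c : C) (f : R -> C) (a b : R) : Ccurve f ->
  CInt (fun t => c * f t) a b = c * CInt f a b.
Proof.
  intros Hf. destruct (Ccurve_ex_RInt f a b Hf) as [H1 H2].
  assert (S : forall k g, ex_RInt g a b -> is_RInt (fun t => k * g t)%R a b (k * RInt g a b)%R).
  { intros k g Hg. apply (is_RInt_scal (V := R_NormedModule)).
    apply (RInt_correct (V := R_CompleteNormedModule)), Hg. }
  unfold CInt, Cmult. f_equal; apply is_RInt_unique.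
  - apply (is_RInt_minus (V := R_NormedModule)); apply S; assumption.
  - apply (is_RInt_plus (V := R_NormedModule)); apply S; assumption.
Qed.

Lemma CInt_minus (f g : R -> C) (a b : R) : Ccurve f -> Ccurve g ->
  CInt (fun t => f t - g t) a b = CInt f a b - CInt g a b.
Proof.
  intros Hf Hg. rewrite (CInt_ext _ (fun t => f t + (-(1)) * g t)) by (intros t; ring).
  assert (Hg' := Ccurve_mult _ _ (Ccurve_const (-(1))) Hg).
  rewrite CInt_plus, CInt_scal by assumption. ring.
Qed.

Lemma CInt_const (c : C) (a b : R) : CInt (fun _ => c) a b = RtoC (b - a) * c.
Proof.
  unfold CInt. rewrite !RInt_const. destruct c as [x y].
  unfold RtoC, Cmult, scal; simpl. unfold mult; simpl. f_equal; ring.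
Qed.

(** Real and imaginary parts are each bounded by [(b - a) * M]; this is the source of the factor 2
    in the Cauchy estimates. *)
Lemma Cmod_CInt_le (f : R -> C) (a b M : R) : (a <= b)%R -> Ccurve f ->
  (forall t, (a <= t <= b)%R -> (Cmod (f t) <= M)%R) ->
  (Cmod (CInt f a b) <= 2 * (b - a) * M)%R.
Proof.
  intros Hab Hf HM. destruct (Ccurve_ex_RInt f a b Hf) as [H1 H2].
  eapply Rle_trans; [apply Cmod_le_re_im|]. simpl.
  assert (A : forall g, ex_RInt g a b -> (forall t, Rabs (g t) <= Cmod (f t))%R ->
    (Rabs (RInt g a b) <= (b - a) * M)%R).
  { intros g Hg B. apply abs_RInt_le_const; auto.
    intros t Ht. eapply Rle_trans; [apply B|]. auto. }
  pose proof (A _ H1 (fun t => re_le_Cmod (f t))). pose proof (A _ H2 (fun t => im_le_Cmod (f t))).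
  simpl in *. lra.
Qed.

Lemma is_derive_R_eps (f : R -> R) (x l : R) :
  (forall eps, (0 < eps)%R -> exists del, (0 < del)%R /\
    forall u, (Rabs (u - x) < del)%R -> (Rabs (f u - f x - l * (u - x)) <= eps * Rabs (u - x))%R) ->
  is_derive f x l.
Proof.
  intros H. split; [apply is_linear_scal_l|].
  intros y Hy eps.
  assert (E : x = y) by exact (is_filter_lim_locally_unique _ _ Hy). subst y.
  destruct (H eps (cond_pos eps)) as [d [Hd H']].
  exists (mkposreal d Hd). intros u Hu. specialize (H' u Hu).
  rewrite (Rmult_comm l) in H'. exact H'.
Qed.

Lemma Cdiff_at_line (h : C -> C) (c d l : C) (t : R) : Cdiff_at h (c + RtoC t * d) l ->
  is_derive (fun u => Re (h (c + RtoC u * d))) t (Re (l * d)) /\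
  is_derive (fun u => Im (h (c + RtoC u * d))) t (Im (l * d)).
Proof.
  intros H.
  assert (A : forall eps, (0 < eps)%R -> exists del, (0 < del)%R /\
    forall u, (Rabs (u - t) < del)%R ->
    (Cmod (h (c + RtoC u * d)%C - h (c + RtoC t * d)%C - RtoC (u - t) * (l * d))%C
      <= eps * Rabs (u - t))%R).
  { intros eps Heps.
    destruct (pos_div_succ eps 1 (Cmod d) Heps Rlt_0_1 (Cmod_ge_0 d)) as [e [He E]].
    destruct (H e He) as [del [Hd H']].
    destruct (pos_div_succ del 1 (Cmod d) Hd Rlt_0_1 (Cmod_ge_0 d)) as [e' [He' E']].
    exists e'. split; [exact He'|]. intros u Hu.
    specialize (H' (RtoC (u - t) * d)).
    assert (Ew : Cmod (RtoC (u - t) * d) = (Rabs (u - t) * Cmod d)%R)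
      by (rewrite Cmod_mult, Cmod_R; reflexivity).
    rewrite Ew in H'. pose proof (Cmod_ge_0 d). pose proof (Rabs_pos (u - t)).
    replace (c + RtoC t * d + RtoC (u - t) * d) with (c + RtoC u * d) in H'
      by (rewrite RtoC_minus; ring).
    replace (RtoC (u - t) * (l * d)) with (l * (RtoC (u - t) * d)) by ring.
    eapply Rle_trans; [apply H'; nra|]. nra. }
  split; apply is_derive_R_eps; intros eps Heps; destruct (A eps Heps) as [del [Hd A']];
    exists del; split; auto; intros u Hu; specialize (A' u Hu);
    (eapply Rle_trans; [|exact A']).
  - eapply Rle_trans; [|apply re_le_Cmod]. right. f_equal.
    destruct (h (c + RtoC u * d)), (h (c + RtoC t * d)), (l * d). simpl. ring.
  - eapply Rle_trans; [|apply im_le_Cmod]. right. f_equal.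
    destruct (h (c + RtoC u * d)), (h (c + RtoC t * d)), (l * d). simpl. ring.
Qed.

(** The fundamental theorem of calculus for both components along a segment; [d] is the velocity of
    the parametrization. *)
Lemma CInt_line_primitive (P p : C -> C) (c d : C) (a b : R) :
  (forall z, Cdiff_at P z (p z)) -> (forall z, Ccont_at p z) ->
  CInt (fun t => p (c + RtoC t * d)) a b * d = P (c + RtoC b * d) - P (c + RtoC a * d).
Proof.
  intros HP Hp.
  assert (Hc : Ccurve (fun t => p (c + RtoC t * d))) by (apply Ccurve_comp; [apply Ccurve_line|auto]).
  assert (Hc' := Ccurve_mult _ _ (Ccurve_const d) Hc).
  rewrite Cmult_comm, <- CInt_scal by exact Hc.
  assert (D : forall t, is_derive (fun u => Re (P (c + RtoC u * d))) t (Re (d * p (c + RtoC t * d))) /\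
    is_derive (fun u => Im (P (c + RtoC u * d))) t (Im (d * p (c + RtoC t * d)))).
  { intros t. rewrite (Cmult_comm d). apply Cdiff_at_line, HP. }
  apply injective_projections; apply is_RInt_unique.
  - apply (is_RInt_derive (V := R_CompleteNormedModule) (fun u => Re (P (c + RtoC u * d)))).
    + intros t _. apply D.
    + intros t _. apply Hc'.
  - apply (is_RInt_derive (V := R_CompleteNormedModule) (fun u => Im (P (c + RtoC u * d)))).
    + intros t _. apply D.
    + intros t _. apply Hc'.
Qed.

(** * Goursat's lemma and the Cauchy formula *)

(** The contour integral along the boundary, counterclockwise: bottom, right, top, left. On the
    vertical sides dz = i dt. *)
Definition rect_int (f : C -> C) (x1 x2 y1 y2 : R) : C :=
  CInt (fun t => f (t, y1)) x1 x2 + Ci * CInt (fun t => f (x2, t)) y1 y2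
  - CInt (fun t => f (t, y2)) x1 x2 - Ci * CInt (fun t => f (x1, t)) y1 y2.

Lemma horizontal_line (x y : R) : (x, y) = (0%R, y) + RtoC x * 1.
Proof. unfold RtoC, Cplus, Cmult; simpl. f_equal; ring. Qed.

Lemma vertical_line (x y : R) : (x, y) = (x, 0%R) + RtoC y * Ci.
Proof. unfold RtoC, Ci, Cplus, Cmult; simpl. f_equal; ring. Qed.

Lemma Ccurve_horizontal (f : C -> C) (y : R) :
  (forall z, Ccont_at f z) -> Ccurve (fun t => f (t, y)).
Proof.
  intros Hf. apply (Ccurve_ext (fun t => f ((0%R, y) + RtoC t * 1))).
  - intros t. now rewrite <- horizontal_line.
  - apply Ccurve_comp; [apply Ccurve_line|auto].
Qed.

Lemma Ccurve_vertical (f : C -> C) (x : R) :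
  (forall z, Ccont_at f z) -> Ccurve (fun t => f (x, t)).
Proof.
  intros Hf. apply (Ccurve_ext (fun t => f ((x, 0%R) + RtoC t * Ci))).
  - intros t. now rewrite <- vertical_line.
  - apply Ccurve_comp; [apply Ccurve_line|auto].
Qed.

Lemma CInt_vertical_primitive (P p : C -> C) (x a b : R) :
  (forall z, Cdiff_at P z (p z)) -> (forall z, Ccont_at p z) ->
  Ci * CInt (fun t => p (x, t)) a b = P (x, b) - P (x, a).
Proof.
  intros HP Hp. rewrite (vertical_line x b), (vertical_line x a).
  rewrite <- (CInt_line_primitive P p) by auto. rewrite Cmult_comm. f_equal.
  apply CInt_ext. intros t. now rewrite <- vertical_line.
Qed.

Lemma CInt_horizontal_primitive (P p : C -> C) (y a b : R) :
  (forall z, Cdiff_at P z (p z)) -> (forall z, Ccont_at p z) ->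
  CInt (fun t => p (t, y)) a b = P (b, y) - P (a, y).
Proof.
  intros HP Hp. rewrite (horizontal_line b y), (horizontal_line a y).
  rewrite <- (CInt_line_primitive P p) by auto. rewrite Cmult_1_r.
  apply CInt_ext. intros t. now rewrite <- horizontal_line.
Qed.

Lemma rect_int_primitive (P p : C -> C) (x1 x2 y1 y2 : R) :
  (forall z, Cdiff_at P z (p z)) -> (forall z, Ccont_at p z) -> rect_int p x1 x2 y1 y2 = 0.
Proof.
  intros HP Hp. unfold rect_int.
  rewrite !(CInt_horizontal_primitive P p), !(CInt_vertical_primitive P p) by auto. ring.
Qed.

(** The inner sides are traversed twice in opposite directions and cancel. *)
Lemma rect_int_split (f : C -> C) (x1 x2 x3 y1 y2 y3 : R) : (forall z, Ccont_at f z) ->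
  rect_int f x1 x3 y1 y3 = rect_int f x1 x2 y1 y2 + rect_int f x2 x3 y1 y2
    + rect_int f x1 x2 y2 y3 + rect_int f x2 x3 y2 y3.
Proof.
  intros Hf. unfold rect_int.
  rewrite <- !(CInt_Chasles (fun t => f (t, _)) x1 x2 x3) by (apply Ccurve_horizontal, Hf).
  rewrite <- !(CInt_Chasles (fun t => f (_, t)) y1 y2 y3) by (apply Ccurve_vertical, Hf).
  ring.
Qed.

Lemma rect_int_minus (f g : C -> C) (x1 x2 y1 y2 : R) :
  (forall z, Ccont_at f z) -> (forall z, Ccont_at g z) ->
  rect_int (fun z => f z - g z) x1 x2 y1 y2 = rect_int f x1 x2 y1 y2 - rect_int g x1 x2 y1 y2.
Proof.
  intros Hf Hg. unfold rect_int.
  rewrite !(CInt_minus (fun t => f (t, _)) (fun t => g (t, _))) by (apply Ccurve_horizontal; auto).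
  rewrite !(CInt_minus (fun t => f (_, t)) (fun t => g (_, t))) by (apply Ccurve_vertical; auto).
  ring.
Qed.

(** The perimeter is [2 * (a + b)]; the other factor 2 comes from [Cmod_CInt_le]. *)
Lemma rect_int_le (f : C -> C) (x y a b M : R) :
  (0 <= a)%R -> (0 <= b)%R -> (forall z, Ccont_at f z) ->
  (forall z, (x <= Re z <= x + a)%R -> (y <= Im z <= y + b)%R -> (Cmod (f z) <= M)%R) ->
  (Cmod (rect_int f x (x + a) y (y + b)) <= 4 * (a + b) * M)%R.
Proof.
  intros Ha Hb Hf HM. unfold rect_int.
  assert (H : forall y', (y <= y' <= y + b)%R ->
    (Cmod (CInt (fun t => f (t, y')) x (x + a)) <= 2 * a * M)%R).
  { intros y' Hy'. replace a with (x + a - x)%R at 2 by ring.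
    apply Cmod_CInt_le; [lra|apply Ccurve_horizontal, Hf|]. intros t Ht. apply HM; simpl; lra. }
  assert (V : forall x', (x <= x' <= x + a)%R ->
    (Cmod (Ci * CInt (fun t => f (x', t)) y (y + b)) <= 2 * b * M)%R).
  { intros x' Hx'. rewrite Cmod_mult, Cmod_Ci, Rmult_1_l. replace b with (y + b - y)%R at 2 by ring.
    apply Cmod_CInt_le; [lra|apply Ccurve_vertical, Hf|]. intros t Ht. apply HM; simpl; lra. }
  eapply Rle_trans; [apply Cmod_triangle_minus|].
  eapply Rle_trans; [apply Rplus_le_compat_r, Cmod_triangle_minus|].
  eapply Rle_trans; [apply Rplus_le_compat_r, Rplus_le_compat_r, Cmod_triangle|].
  pose proof (H y ltac:(lra)). pose proof (H (y + b)%R ltac:(lra)).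
  pose proof (V x ltac:(lra)). pose proof (V (x + a)%R ltac:(lra)). lra.
Qed.

Definition entire (f : C -> C) : Prop := forall z, exists l, Cdiff_at f z l.

Lemma entire_Ccont_at (f : C -> C) : entire f -> forall z, Ccont_at f z.
Proof. intros H z. destruct (H z) as [l Hl]. exact (Cdiff_at_continuous f z l Hl). Qed.

Lemma Cdiff_at_affine (c l z : C) : Cdiff_at (fun w => c + l * w) z l.
Proof.
  eapply Cdiff_at_ext; cycle 2.
  - apply Cdiff_at_plus; [apply (Cdiff_at_const c)|].
    apply Cdiff_at_mult; [apply (Cdiff_at_const l)|apply Cdiff_at_id].
  - reflexivity.
  - cbn beta. ring.
Qed.

Lemma rect_int_affine (c l : C) (x1 x2 y1 y2 : R) :
  rect_int (fun z => c + l * z) x1 x2 y1 y2 = 0.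
Proof.
  apply (rect_int_primitive (fun z => c * z + l / 2 * (z * z))).
  - intros z. eapply Cdiff_at_ext; cycle 2.
    + apply Cdiff_at_plus; (apply Cdiff_at_mult; [apply Cdiff_at_const|]);
        [apply Cdiff_at_id|apply Cdiff_at_mult; apply Cdiff_at_id].
    + reflexivity.
    + cbn beta. field.
  - intros z. exact (Cdiff_at_continuous _ _ _ (Cdiff_at_affine c l z)).
Qed.

(** For fixed [eps], the bound [4 * eps * (a + b) ^ 2] passes from the four quarters to the whole,
    since halving both sides divides it by 4. On small rectangles around a point it holds because
    the affine approximation there has integral 0 and differs from [f] by at most [eps * (a + b)].
    Bisection gives it for every rectangle, and [eps] is arbitrary. *)
Lemma Goursat_rectangle (f : C -> C) (x y a b : R) : entire f ->
  (0 <= a)%R -> (0 <= b)%R -> rect_int f x (x + a) y (y + b) = 0.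
Proof.
  intros Hf Ha Hb.
  assert (Hc := entire_Ccont_at f Hf).
  assert (A : forall eps, (0 < eps)%R -> forall x y a b, (0 <= a)%R -> (0 <= b)%R ->
    (Cmod (rect_int f x (x + a) y (y + b)) <= 4 * eps * (a + b) ^ 2)%R).
  { intros eps Heps.
    apply (rectangle_bisection
      (fun x y a b => Cmod (rect_int f x (x + a) y (y + b)) <= 4 * eps * (a + b) ^ 2)%R).
    - clear x y a b Ha Hb. intros x y a b Ha Hb H1 H2 H3 H4.
      rewrite (rect_int_split f x (x + a / 2) (x + a) y (y + b / 2) (y + b)) by exact Hc.
      replace (x + a / 2 + a / 2)%R with (x + a)%R in * by field.
      replace (y + b / 2 + b / 2)%R with (y + b)%R in * by field.
      eapply Rle_trans; [apply Cmod_triangle|].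
      eapply Rle_trans; [apply Rplus_le_compat_r, Cmod_triangle|].
      eapply Rle_trans; [apply Rplus_le_compat_r, Rplus_le_compat_r, Cmod_triangle|].
      replace (4 * eps * (a + b) ^ 2)%R with (4 * (4 * eps * (a / 2 + b / 2) ^ 2))%R by field.
      lra.
    - intros c d. destruct (Hf (c, d)) as [l Hl]. destruct (Hl eps Heps) as [del [Hd H]].
      (* Points of the rectangle are at distance at most [a + b] from [(c, d)], hence less than
         [del]. *)
      exists (del / 2)%R. split; [lra|]. clear x y a b Ha Hb. intros x y a b Ha Hb Hx Hy.
      set (A := fun z => (f (c, d) - l * (c, d)) + l * z).
      assert (HA : forall z, Ccont_at A z)
        by (intros z; exact (Cdiff_at_continuous _ _ _ (Cdiff_at_affine _ l z))).
      replace (rect_int f x (x + a) y (y + b))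
        with (rect_int (fun z => f z - A z) x (x + a) y (y + b)).
      2:{ rewrite rect_int_minus by auto. unfold A. rewrite rect_int_affine. ring. }
      replace (4 * eps * (a + b) ^ 2)%R with (4 * (a + b) * (eps * (a + b)))%R by ring.
      apply rect_int_le; try lra.
      + intros z. destruct (Hf z) as [m Hm].
        exact (Cdiff_at_continuous _ _ _ (Cdiff_at_minus _ _ _ _ _ Hm (Cdiff_at_affine _ l z))).
      + intros z Hz1 Hz2.
        assert (N : (Cmod (z - (c, d)) <= a + b)%R).
        { eapply Rle_trans; [apply Cmod_le_re_im|]. destruct z as [p q]; simpl in *.
          apply Rplus_le_compat; apply Rabs_le; lra. }
        specialize (H (z - (c, d)) ltac:(lra)).
        replace ((c, d) + (z - (c, d))) with z in H by ring.
        unfold A. replace (f z - (f (c, d) - l * (c, d) + l * z))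
          with (f z - f (c, d) - l * (z - (c, d))) by ring.
        nra. }
  apply Cmod_eq_0. apply Rle_antisym; [|apply Cmod_ge_0].
  apply le_epsilon. intros eps Heps. rewrite Rplus_0_l.
  destruct (pos_div_succ eps 4 ((a + b) ^ 2) Heps ltac:(lra) ltac:(nra)) as [e [He E]].
  specialize (A e He x y a b Ha Hb). nra.
Qed.

Lemma entire_comp (f g : C -> C) : entire f -> entire g -> entire (fun z => f (g z)).
Proof.
  intros Hf Hg z. destruct (Hg z) as [m Hm]. destruct (Hf (g z)) as [l Hl].
  exists (l * m). now apply Cdiff_at_comp.
Qed.

Lemma entire_mult (f g : C -> C) : entire f -> entire g -> entire (fun z => f z * g z).
Proof.
  intros Hf Hg z. destruct (Hf z) as [l Hl]. destruct (Hg z) as [m Hm].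
  eexists. now apply Cdiff_at_mult; [exact Hl|exact Hm].
Qed.

Lemma Cdiff_at_Cexp_opp (z : C) : Cdiff_at (fun w => Cexp (- w)) z (- Cexp (- z)).
Proof.
  eapply Cdiff_at_ext; cycle 2.
  - apply (Cdiff_at_comp Cexp (fun w => 0 + (-(1)) * w)); [apply Cdiff_at_Cexp|apply Cdiff_at_affine].
  - intros w. cbn beta. f_equal. ring.
  - cbn beta. replace (0 + (-(1)) * z) with (- z) by ring. ring.
Qed.

Lemma Cexp_Cexp_opp (z : C) : Cexp z * Cexp (- z) = 1.
Proof. rewrite <- Cexp_add. replace (z + - z) with (RtoC 0) by ring. apply Cexp_0. Qed.

Lemma Cexp_2PI (x : R) : Cexp (x, 2 * PI)%R = Cexp (x, 0)%R.
Proof. unfold Cexp; simpl. rewrite cos_2PI, sin_2PI, cos_0, sin_0. reflexivity. Qed.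

Lemma Cexp_opp_2PI (x : R) : Cexp (- (x, 2 * PI)%R) = Cexp (- (x, 0)%R).
Proof.
  unfold Cexp; simpl. rewrite Ropp_0, cos_neg, sin_neg, cos_2PI, sin_2PI, cos_0, sin_0.
  f_equal. ring.
Qed.

(** With zeta = z + exp(u + iv) and d zeta = i (zeta - z) dv, this is -i times the contour integral
    of f(zeta) / (zeta - z)^2 over the circle of radius exp(u): Cauchy's kernel for f'(z). *)
Definition circle_int (f : C -> C) (z : C) (u : R) : C :=
  CInt (fun v => f (z + Cexp (u, v)) * Cexp (- (u, v))) 0 (2 * PI).

Lemma entire_Cexp_opp : entire (fun w => Cexp (- w)).
Proof. intros z. eexists. apply Cdiff_at_Cexp_opp. Qed.

Lemma entire_Cexp : entire Cexp.
Proof. intros z. eexists. apply Cdiff_at_Cexp. Qed.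

Lemma entire_circle_integrand (f : C -> C) (z : C) : entire f ->
  entire (fun w => f (z + Cexp w) * Cexp (- w)).
Proof.
  intros Hf. apply entire_mult; [|apply entire_Cexp_opp].
  apply entire_comp; [exact Hf|]. intros w. eexists.
  apply Cdiff_at_plus; [apply Cdiff_at_const|apply Cdiff_at_Cexp].
Qed.

(* In the coordinate [w = log (zeta - z)] an annulus around [z] becomes a rectangle of height
   [2 PI], and the integrals over its horizontal sides cancel by periodicity of [Cexp]. *)
Lemma circle_int_radius (f : C -> C) (z : C) (u u' : R) : entire f -> (u <= u')%R ->
  circle_int f z u = circle_int f z u'.
Proof.
  intros Hf Hu.
  pose proof (Goursat_rectangle _ u 0 (u' - u) (2 * PI) (entire_circle_integrand f z Hf)
    ltac:(lra) ltac:(pose proof PI_RGT_0; lra)) as G.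
  unfold rect_int in G.
  replace (u + (u' - u))%R with u' in G by ring.
  replace (0 + 2 * PI)%R with (2 * PI)%R in G by ring.
  fold (circle_int f z u) in G. fold (circle_int f z u') in G.
  rewrite (CInt_ext (fun t => f (z + Cexp (t, 2 * PI)%R) * Cexp (- (t, 2 * PI)%R))
    (fun t => f (z + Cexp (t, 0)%R) * Cexp (- (t, 0)%R))) in G.
  2:{ intros t. rewrite Cexp_2PI, Cexp_opp_2PI. reflexivity. }
  assert (E : Ci * (circle_int f z u' - circle_int f z u) = 0).
  { rewrite <- G. ring. }
  assert (N : Ci <> 0) by (apply Cmod_gt_0; rewrite Cmod_Ci; lra).
  destruct (Ceq_dec (circle_int f z u) (circle_int f z u')) as [|D]; [assumption|].
  exfalso. apply (Cmult_neq_0 _ _ N) in E; [assumption|].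
  intros E'. apply D. symmetry.
  replace (circle_int f z u') with ((circle_int f z u' - circle_int f z u) + circle_int f z u) by ring.
  rewrite E'. ring.
Qed.

(** The primitive [- Cexp (- w)] takes the same value at both ends of a full period. *)
Lemma CInt_Cexp_opp (u : R) : CInt (fun v => Cexp (- (u, v))) 0 (2 * PI) = 0.
Proof.
  assert (E : Ci * CInt (fun v => Cexp (- (u, v))) 0 (2 * PI) = 0).
  { rewrite (CInt_vertical_primitive (fun w => - Cexp (- w)) (fun w => Cexp (- w))).
    - rewrite Cexp_opp_2PI. ring.
    - intros z. eapply Cdiff_at_ext; cycle 2.
      + apply (Cdiff_at_minus (fun _ => 0)); [apply Cdiff_at_const|apply Cdiff_at_Cexp_opp].
      + intros w. cbn beta. ring.
      + ring.
    - apply entire_Ccont_at, entire_Cexp_opp. }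
  replace (CInt (fun v => Cexp (- (u, v))) 0 (2 * PI))
    with (- Ci * (Ci * CInt (fun v => Cexp (- (u, v))) 0 (2 * PI))).
  - rewrite E. ring.
  - generalize (CInt (fun v => Cexp (- (u, v))) 0 (2 * PI)). intros [p q].
    unfold Ci, Cmult, Copp; simpl. f_equal; ring.
Qed.

Lemma Cmod_Cexp_vertical (u v : R) : Cmod (Cexp (u, v)) = exp u.
Proof. apply Cmod_Cexp. Qed.

Lemma Cmod_Cexp_opp_vertical (u v : R) : Cmod (Cexp (- (u, v))) = exp (- u).
Proof. apply Cmod_Cexp. Qed.

(** The integral does not depend on the radius, so the circle may shrink. There the integrand is
    [f z * Cexp (- w) + l] up to [eps]; the first summand integrates to 0, the second to
    [2 * PI * l]. *)
Lemma Cauchy_formula_derivative (f : C -> C) (z l : C) (u : R) : entire f -> Cdiff_at f z l ->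
  circle_int f z u = RtoC (2 * PI) * l.
Proof.
  intros Hf Hl. pose proof PI_RGT_0 as HPI.
  assert (A : forall eps, (0 < eps)%R ->
    (Cmod (circle_int f z u - RtoC (2 * PI) * l) <= 2 * (2 * PI) * eps)%R).
  { intros eps Heps. destruct (Hl eps Heps) as [del [Hd H]].
    (* The minimum with [u] puts the radii in the order that [circle_int_radius] expects;
       [ln (del / 2)] brings the new radius below [del]. *)
    set (u' := Rmin u (ln (del / 2))).
    assert (Hu' : (exp u' < del)%R).
    { apply Rle_lt_trans with (exp (ln (del / 2))).
      - destruct (Rmin_r u (ln (del / 2))) as [L|L]; [left; apply exp_increasing, L|right; now f_equal].
      - rewrite exp_ln; lra. }
    rewrite <- (circle_int_radius f z u' u Hf (Rmin_l _ _)).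
    set (r := fun w : C => f (z + Cexp w) * Cexp (- w) - (f z * Cexp (- w) + l)).
    assert (C1 : Ccurve (fun v => f (z + Cexp (u', v)) * Cexp (- (u', v)))).
    { apply (Ccurve_vertical (fun w => f (z + Cexp w) * Cexp (- w))).
      apply entire_Ccont_at, entire_circle_integrand, Hf. }
    assert (C2 : Ccurve (fun v => Cexp (- (u', v)))).
    { apply (Ccurve_vertical (fun w => Cexp (- w))). apply entire_Ccont_at, entire_Cexp_opp. }
    assert (C3 : Ccurve (fun v => f z * Cexp (- (u', v)))).
    { apply Ccurve_mult; [apply Ccurve_const|exact C2]. }
    assert (C4 : Ccurve (fun v => f z * Cexp (- (u', v)) + l)).
    { apply Ccurve_plus; [exact C3|apply Ccurve_const]. }
    replace (circle_int f z u' - RtoC (2 * PI) * l) with (CInt (fun v => r (u', v)) 0 (2 * PI)).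
    2:{ unfold r. rewrite CInt_minus by assumption. fold (circle_int f z u').
        rewrite CInt_plus by (assumption || apply Ccurve_const).
        rewrite CInt_scal, CInt_Cexp_opp, CInt_const by assumption.
        rewrite Rminus_0_r. ring. }
    replace (2 * (2 * PI))%R with (2 * (2 * PI - 0))%R by ring.
    apply Cmod_CInt_le; [lra|apply Ccurve_minus; assumption|].
    intros v _. unfold r.
    replace (f (z + Cexp (u', v)) * Cexp (- (u', v)) - (f z * Cexp (- (u', v)) + l))
      with ((f (z + Cexp (u', v)) - f z - l * Cexp (u', v)) * Cexp (- (u', v))).
    2:{ transitivity (f (z + Cexp (u', v)) * Cexp (- (u', v)) - f z * Cexp (- (u', v))
          - l * (Cexp (u', v) * Cexp (- (u', v)))); [ring|]. rewrite Cexp_Cexp_opp. ring. }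
    rewrite Cmod_mult, Cmod_Cexp_opp_vertical.
    specialize (H (Cexp (u', v))). rewrite Cmod_Cexp_vertical in H. specialize (H Hu').
    apply Rle_trans with (eps * exp u' * exp (- u'))%R.
    - apply Rmult_le_compat_r; [left; apply exp_pos|exact H].
    - rewrite Rmult_assoc, <- exp_plus, Rplus_opp_r, exp_0. lra. }
  assert (E : circle_int f z u - RtoC (2 * PI) * l = 0).
  { apply Cmod_eq_0. apply Rle_antisym; [|apply Cmod_ge_0].
    apply le_epsilon. intros eps Heps. rewrite Rplus_0_l.
    eapply Rle_trans; [apply (A (eps / (4 * PI))%R), Rdiv_lt_0_compat; lra|].
    right. field. lra. }
  replace (circle_int f z u) with ((circle_int f z u - RtoC (2 * PI) * l) + RtoC (2 * PI) * l) by ring.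
  rewrite E. ring.
Qed.

(** * Cauchy estimates *)

(** The formula is read on the circle of radius [r], that is at [u = ln r], where [Cexp (- w)] has
    modulus [1 / r]. *)
Lemma Cauchy_estimate (f : C -> C) (z l : C) (r M : R) : entire f -> Cdiff_at f z l -> (0 < r)%R ->
  (forall w, (Cmod (w - z) <= r)%R -> (Cmod (f w) <= M)%R) -> (Cmod l <= 2 * M / r)%R.
Proof.
  intros Hf Hl Hr HM. pose proof PI_RGT_0 as HPI.
  assert (B : (Cmod (circle_int f z (ln r)) <= 2 * (2 * PI - 0) * (M / r))%R).
  { apply Cmod_CInt_le; [lra| |].
    - apply (Ccurve_vertical (fun w => f (z + Cexp w) * Cexp (- w))).
      apply entire_Ccont_at, entire_circle_integrand, Hf.
    - intros v _. rewrite Cmod_mult, Cmod_Cexp_opp_vertical, exp_Ropp, exp_ln by exact Hr.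
      apply Rmult_le_compat_r; [left; apply Rinv_0_lt_compat, Hr|]. apply HM.
      replace (z + Cexp (ln r, v) - z) with (Cexp (ln r, v)) by ring.
      rewrite Cmod_Cexp_vertical, exp_ln by exact Hr. lra. }
  rewrite (Cauchy_formula_derivative f z l _ Hf Hl), Cmod_mult, Cmod_R, Rabs_pos_eq in B by lra.
  apply Rmult_le_reg_l with (2 * PI)%R; [lra|].
  replace (2 * PI * (2 * M / r))%R with (2 * (2 * PI - 0) * (M / r))%R by (field; lra).
  exact B.
Qed.

(** Compactness by bisection: a bound on the four quarters gives one on the rectangle, and
    continuity gives one near each point. *)
Lemma continuous_bounded_disc (f : C -> C) (z : C) (r : R) :
  (forall w, Ccont_at f w) -> (0 <= r)%R ->
  exists M, (0 <= M)%R /\ forall w, (Cmod (w - z) <= r)%R -> (Cmod (f w) <= M)%R.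
Proof.
  intros Hf Hr.
  set (P := fun x y a b => exists M, forall w, (x <= Re w <= x + a)%R -> (y <= Im w <= y + b)%R ->
    (Cmod (f w) <= M)%R).
  assert (HP : forall x y a b, (0 <= a)%R -> (0 <= b)%R -> P x y a b).
  { apply rectangle_bisection.
    - intros x y a b Ha Hb [M1 H1] [M2 H2] [M3 H3] [M4 H4].
      exists (Rmax (Rmax M1 M2) (Rmax M3 M4)). intros w Hx Hy.
      destruct (Rle_dec (Re w) (x + a / 2)), (Rle_dec (Im w) (y + b / 2)).
      + eapply Rle_trans; [apply H1; lra|]. eapply Rle_trans; [|apply Rmax_l]. apply Rmax_l.
      + eapply Rle_trans; [apply H3; lra|]. eapply Rle_trans; [|apply Rmax_r]. apply Rmax_l.
      + eapply Rle_trans; [apply H2; lra|]. eapply Rle_trans; [|apply Rmax_l]. apply Rmax_r.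
      + eapply Rle_trans; [apply H4; lra|]. eapply Rle_trans; [|apply Rmax_r]. apply Rmax_r.
    - intros c d. destruct (Hf (c, d) 1%R Rlt_0_1) as [del [Hd H]].
      exists (del / 2)%R. split; [lra|]. intros x y a b Ha Hb Hx Hy.
      exists (Cmod (f (c, d)) + 1)%R. intros w Wx Wy.
      assert (N : (Cmod (w - (c, d)) < del)%R).
      { eapply Rle_lt_trans; [apply Cmod_le_re_im|]. destruct w as [p q]; simpl in *.
        assert (Rabs (p + - c) <= a)%R by (apply Rabs_le; lra).
        assert (Rabs (q + - d) <= b)%R by (apply Rabs_le; lra). lra. }
      specialize (H w N). replace (f w) with (f (c, d) + (f w - f (c, d))) by ring.
      eapply Rle_trans; [apply Cmod_triangle|]. lra. }
  (* The square circumscribed about the disc. *)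
  destruct (HP (Re z - r)%R (Im z - r)%R (2 * r)%R (2 * r)%R) as [M HM]; try lra.
  exists (Rmax 0 M). split; [apply Rmax_l|]. intros w Hw.
  eapply Rle_trans; [apply HM|apply Rmax_r].
  - pose proof (re_le_Cmod (w - z)) as B. destruct w, z; simpl in *.
    assert (B' := Rle_trans _ _ _ B Hw). apply Rabs_le_between in B'. lra.
  - pose proof (im_le_Cmod (w - z)) as B. destruct w, z; simpl in *.
    assert (B' := Rle_trans _ _ _ B Hw). apply Rabs_le_between in B'. lra.
Qed.

(** * The mean value inequality and the differentiability of the derivative *)

Lemma Cmean_value (f f' : C -> C) (z w : C) (L : R) :
  (forall t, (0 <= t <= 1)%R -> Cdiff_at f (z + RtoC t * w) (f' (z + RtoC t * w)) /\
    (Cmod (f' (z + RtoC t * w)%C) <= L)%R) ->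
  (Cmod (f (z + w)%C - f z)%C <= 2 * L * Cmod w)%R.
Proof.
  intros H.
  assert (D : forall t, (0 <= t <= 1)%R ->
    is_derive (fun u => Re (f (z + RtoC u * w))) t (Re (f' (z + RtoC t * w) * w)) /\
    is_derive (fun u => Im (f (z + RtoC u * w))) t (Im (f' (z + RtoC t * w) * w))).
  { intros t Ht. apply Cdiff_at_line, H, Ht. }
  assert (B : forall t, (0 <= t <= 1)%R -> (Cmod (f' (z + RtoC t * w) * w)%C <= L * Cmod w)%R).
  { intros t Ht. rewrite Cmod_mult. apply Rmult_le_compat_r; [apply Cmod_ge_0|]. apply H, Ht. }
  (* The mean value theorem is real, with different intermediate points for the two components;
     adding the two bounds produces the factor 2. *)
  assert (M : forall g dg : R -> R, (forall t, (0 <= t <= 1)%R -> is_derive g t (dg t)) ->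
    (forall t, (0 <= t <= 1)%R -> (Rabs (dg t) <= L * Cmod w)%R) ->
    (Rabs (g 1 - g 0) <= L * Cmod w)%R).
  { intros g dg Hg Hb. destruct (MVT_gen g 0 1 dg) as [c [Hc E]];
      rewrite ?Rmin_left, ?Rmax_right in * by lra.
    - intros t Ht. apply Hg. lra.
    - intros t Ht. apply continuity_pt_filterlim.
      apply (ex_derive_continuous (K := R_AbsRing) (V := R_NormedModule)). eexists. apply Hg, Ht.
    - rewrite E, Rminus_0_r, Rmult_1_r. apply Hb, Hc. }
  eapply Rle_trans; [apply Cmod_le_re_im|].
  pose proof (M _ _ (fun t Ht => proj1 (D t Ht))
    (fun t Ht => Rle_trans _ _ _ (re_le_Cmod _) (B t Ht))) as M1.
  pose proof (M _ _ (fun t Ht => proj2 (D t Ht))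
    (fun t Ht => Rle_trans _ _ _ (im_le_Cmod _) (B t Ht))) as M2.
  cbn beta in M1, M2.
  replace (z + RtoC 1 * w) with (z + w) in M1, M2 by ring.
  replace (z + RtoC 0 * w) with z in M1, M2 by ring.
  unfold Rminus in M1, M2. unfold Re, Im in *. simpl. lra.
Qed.

Lemma segment_in_disc (c z w : C) (r t : R) : (0 <= t <= 1)%R ->
  (Cmod (z - c) <= r)%R -> (Cmod (z + w - c) <= r)%R -> (Cmod (z + RtoC t * w - c) <= r)%R.
Proof.
  intros Ht H1 H2.
  replace (z + RtoC t * w - c) with (RtoC (1 - t) * (z - c) + RtoC t * (z + w - c))
    by (rewrite RtoC_minus; ring).
  eapply Rle_trans; [apply Cmod_triangle|].
  rewrite !Cmod_mult, !Cmod_R, !Rabs_pos_eq by lra. nra.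
Qed.

Lemma Cdiff_at_shift (f : C -> C) (d z l : C) :
  Cdiff_at f (z + d) l -> Cdiff_at (fun w => f (w + d)) z l.
Proof.
  intros H eps Heps. destruct (H eps Heps) as [del [Hd H']]. exists del. split; [exact Hd|].
  intros w Hw. replace (z + w + d) with (z + d + w) by ring. apply H', Hw.
Qed.

Lemma entire_of_derivative (f f' : C -> C) : (forall z, Cdiff_at f z (f' z)) -> entire f.
Proof. intros H z. exists (f' z). apply H. Qed.

(** [f' a - f' b] is the derivative at [b] of [f (w + (a - b)) - f w]. The mean value inequality
    makes this function of size |a - b| near [b], and the Cauchy estimate passes that size on to its
    derivative. So regularity of [f'] is obtained from first derivatives alone. *)
Lemma derivative_locally_lipschitz (f f' : C -> C) (z : C) :
  (forall w, Cdiff_at f w (f' w)) -> exists L, (0 <= L)%R /\ forall a b : C,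
  (Cmod (a - z) <= 3)%R -> (Cmod (b - z) <= 3)%R -> (Cmod (f' a - f' b) <= L * Cmod (a - b))%R.
Proof.
  intros Hf'. assert (Hf := entire_of_derivative f f' Hf').
  (* Each Cauchy estimate uses discs of radius 1: [f] is bounded on radius 5, hence [f'] on radius
     4, hence the Lipschitz bound holds on radius 3. *)
  destruct (continuous_bounded_disc f z 5 (entire_Ccont_at f Hf)) as [M [M0 HM]]; [lra|].
  assert (D : forall w, (Cmod (w - z) <= 4)%R -> (Cmod (f' w) <= 2 * M)%R).
  { intros w Hw. replace (2 * M)%R with (2 * M / 1)%R by field.
    apply (Cauchy_estimate f w (f' w) 1 M Hf (Hf' w) Rlt_0_1).
    intros v Hv. apply HM. replace (v - z) with ((v - w) + (w - z)) by ring.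
    eapply Rle_trans; [apply Cmod_triangle|]. lra. }
  (* From the inside out, the factors 2 come from the bound on [f'], the mean value inequality and
     the final Cauchy estimate. *)
  exists (2 * (2 * (2 * M)))%R. split; [lra|]. intros a b Ha Hb.
  replace (2 * (2 * (2 * M)) * Cmod (a - b))%R with (2 * (2 * (2 * M) * Cmod (a - b)) / 1)%R by field.
  apply (Cauchy_estimate (fun w => f (w + (a - b)) - f w) b).
  - intros w. eexists. apply Cdiff_at_minus; [apply Cdiff_at_shift|]; apply Hf'.
  - apply Cdiff_at_minus; [|apply Hf']. apply Cdiff_at_shift.
    replace (b + (a - b)) with a by ring. apply Hf'.
  - lra.
  - intros w Hw. apply (Cmean_value f f'). intros t Ht. split; [apply Hf'|].
    apply D, segment_in_disc; [exact Ht| |].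
    + replace (w - z) with ((w - b) + (b - z)) by ring.
      eapply Rle_trans; [apply Cmod_triangle|]. lra.
    + replace (w + (a - b) - z) with ((w - b) + (a - z)) by ring.
      eapply Rle_trans; [apply Cmod_triangle|]. lra.
Qed.

Lemma derivative_Ccont_at (f f' : C -> C) (z : C) :
  (forall w, Cdiff_at f w (f' w)) -> Ccont_at f' z.
Proof.
  intros Hf'. destruct (derivative_locally_lipschitz f f' z Hf') as [L [L0 HL]]. intros eps Heps.
  destruct (pos_div_succ eps 1 L Heps Rlt_0_1 L0) as [e [He E]].
  exists (Rmin 3 e). split; [apply Rmin_pos; lra|]. intros w Hw.
  apply Rmin_Rgt_l in Hw as [W1 W2].
  eapply Rle_lt_trans; [apply HL|].
  - lra.
  - replace (z - z) with (RtoC 0) by ring. rewrite Cmod_0. lra.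
  - pose proof (Cmod_ge_0 (w - z)). nra.
Qed.

(* Differentiation under the integral sign in the Cauchy formula for [f'] on the unit circle. *)
Lemma entire_derivative (f f' : C -> C) : (forall z, Cdiff_at f z (f' z)) -> entire f'.
Proof.
  intros Hf' z. pose proof PI_RGT_0 as HPI. assert (Hf := entire_of_derivative f f' Hf').
  destruct (derivative_locally_lipschitz f f' z Hf') as [L [L0 HL]].
  (* A quadratic first-order remainder, uniform in [v] on the unit disc about [z]: this uniformity
     permits the passage under the integral. *)
  assert (T : forall v w : C, (Cmod (v - z) <= 1)%R -> (Cmod w <= 1)%R ->
    (Cmod (f (v + w)%C - f v - f' v * w)%C <= 2 * (L * Cmod w) * Cmod w)%R).
  { intros v w Hv Hw.
    replace (f (v + w) - f v - f' v * w)
      with ((f (v + w) - (0 + f' v * (v + w))) - (f v - (0 + f' v * v))) by ring.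
    apply (Cmean_value (fun x => f x - (0 + f' v * x)) (fun x => f' x - f' v)).
    intros t Ht. split; [apply Cdiff_at_minus; [apply Hf'|apply Cdiff_at_affine]|].
    eapply Rle_trans; [apply HL|].
    - apply segment_in_disc; [exact Ht|lra|].
      replace (v + w - z) with ((v - z) + w) by ring.
      eapply Rle_trans; [apply Cmod_triangle|]. lra.
    - lra.
    - apply Rmult_le_compat_l; [exact L0|].
      replace (v + RtoC t * w - v) with (RtoC t * w) by ring.
      rewrite Cmod_mult, Cmod_R, Rabs_pos_eq by lra. pose proof (Cmod_ge_0 w). nra. }
  (* [u = 0] is the unit circle. Only continuity of [f'] enters this integral; the candidate
     derivative is [K] divided by [2 * PI]. *)
  set (K := circle_int f' z 0).
  exists (/ RtoC (2 * PI) * K). intros eps Heps.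
  destruct (pos_div_succ eps 1 (4 * L) Heps Rlt_0_1 ltac:(lra)) as [e [He E]].
  exists (Rmin 1 e). split; [apply Rmin_pos; lra|]. intros w Hw.
  apply Rmin_Rgt_l in Hw as [W1 W2].
  assert (N : RtoC (2 * PI) <> 0) by (intros Q; apply RtoC_inj in Q; lra).
  assert (Ce : Ccurve (fun v => Cexp (- (0%R, v)))).
  { apply (Ccurve_vertical (fun w => Cexp (- w))). apply entire_Ccont_at, entire_Cexp_opp. }
  assert (Cp : Ccurve (fun v => Cexp (0%R, v))).
  { apply (Ccurve_vertical Cexp). apply entire_Ccont_at, entire_Cexp. }
  assert (Cf : forall x, Ccurve (fun v => f (x + Cexp (0%R, v)) * Cexp (- (0%R, v)))).
  { intros x. apply (Ccurve_vertical (fun w => f (x + Cexp w) * Cexp (- w))).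
    apply entire_Ccont_at, entire_circle_integrand, Hf. }
  assert (Cf' : Ccurve (fun v => f' (z + Cexp (0%R, v)) * Cexp (- (0%R, v)))).
  { apply Ccurve_mult; [|exact Ce]. apply Ccurve_comp; [|intros t; apply (derivative_Ccont_at f), Hf'].
    apply Ccurve_plus; [apply Ccurve_const|exact Cp]. }
  assert (Cw := Ccurve_mult _ _ (Ccurve_const w) Cf').
  set (r := fun v => f (z + w + Cexp (0%R, v)) * Cexp (- (0%R, v))
      - f (z + Cexp (0%R, v)) * Cexp (- (0%R, v))
      - w * (f' (z + Cexp (0%R, v)) * Cexp (- (0%R, v)))).
  (* Two instances of the Cauchy formula turn the integrated remainder of [f] into the remainder of
     [f'] at [z]. *)
  assert (Er : CInt r 0 (2 * PI) = RtoC (2 * PI) * (f' (z + w) - f' z - / RtoC (2 * PI) * K * w)).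
  { unfold r. rewrite CInt_minus, CInt_minus, CInt_scal
      by (try apply Ccurve_minus; auto).
    fold (circle_int f (z + w) 0) (circle_int f z 0) (circle_int f' z 0). fold K.
    rewrite (Cauchy_formula_derivative f (z + w) _ 0 Hf (Hf' _)).
    rewrite (Cauchy_formula_derivative f z _ 0 Hf (Hf' _)). field. exact N. }
  assert (B : (Cmod (CInt r 0 (2 * PI)) <= 2 * (2 * PI - 0) * (2 * (L * Cmod w) * Cmod w))%R).
  { apply Cmod_CInt_le; [lra| |].
    - repeat apply Ccurve_minus; auto.
    - intros v _. unfold r.
      replace (f (z + w + Cexp (0%R, v)) * Cexp (- (0%R, v))
        - f (z + Cexp (0%R, v)) * Cexp (- (0%R, v))
        - w * (f' (z + Cexp (0%R, v)) * Cexp (- (0%R, v))))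
        with ((f (z + Cexp (0%R, v) + w) - f (z + Cexp (0%R, v)) - f' (z + Cexp (0%R, v)) * w)
          * Cexp (- (0%R, v))).
      2:{ replace (z + w + Cexp (0%R, v)) with (z + Cexp (0%R, v) + w) by ring. ring. }
      rewrite Cmod_mult, Cmod_Cexp_opp_vertical, Ropp_0, exp_0, Rmult_1_r.
      apply T; [|lra]. replace (z + Cexp (0%R, v) - z) with (Cexp (0%R, v)) by ring.
      rewrite Cmod_Cexp_vertical, exp_0. lra. }
  rewrite Er, Cmod_mult, Cmod_R, Rabs_pos_eq in B by lra.
  apply Rle_trans with (4 * L * Cmod w * Cmod w)%R.
  - apply Rmult_le_reg_l with (2 * PI)%R; [lra|]. eapply Rle_trans; [exact B|]. right. ring.
  - pose proof (Cmod_ge_0 w). apply Rmult_le_compat_r; [assumption|]. nra.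
Qed.

(** * Taylor coefficients at a distance from a simple pole *)

Lemma entire_C_derive (f : C -> C) (z : C) : entire f -> Cdiff_at f z (C_derive f z).
Proof. intros H. destruct (H z) as [l Hl]. now rewrite (Cdiff_at_C_derive f z l Hl). Qed.

Lemma entire_C_derive_n (f : C -> C) (k : nat) : entire f -> entire (C_derive_n f k).
Proof.
  intros H. induction k as [|k IH]; [exact H|].
  apply (entire_derivative (C_derive_n f k)). intros z. now apply entire_C_derive.
Qed.

(** Each differentiation spends [rho] of the available radius and costs a factor [2 / rho]. At the
    centre, for k > 0, [rho = r / k] is the largest choice. *)
Lemma Cauchy_estimate_n (f : C -> C) (s : C) (r rho M : R) : entire f -> (0 < rho)%R ->
  (forall w, (Cmod (w - s) <= r)%R -> (Cmod (f w) <= M)%R) ->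
  forall k w, (Cmod (w - s) <= r - INR k * rho)%R ->
    (Cmod (C_derive_n f k w) <= M * (2 / rho) ^ k)%R.
Proof.
  intros Hf Hrho HM k. induction k as [|k IH]; intros w Hw.
  - simpl in *. rewrite Rmult_1_r. apply HM. lra.
  - rewrite S_INR in Hw.
    replace (M * (2 / rho) ^ S k)%R with (2 * (M * (2 / rho) ^ k) / rho)%R by (simpl; field; lra).
    assert (E := entire_C_derive_n f k Hf).
    apply (Cauchy_estimate (C_derive_n f k) w); auto.
    + now apply entire_C_derive.
    + intros v Hv. apply IH. replace (v - s) with ((v - w) + (w - s)) by ring.
      eapply Rle_trans; [apply Cmod_triangle|]. lra.
Qed.

Lemma exp_pow_INR (n : nat) (x : R) : (exp x ^ n = exp (INR n * x))%R.
Proof.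
  induction n as [|n IH]; [simpl; rewrite Rmult_0_l, exp_0; reflexivity|].
  rewrite S_INR. simpl. rewrite IH, <- exp_plus. f_equal. ring.
Qed.

(** Induction through (1 + 1/n)^n <= e <= 3; it absorbs the n^n that the iterated Cauchy estimate
    produces. *)
Lemma pow_self_le_fact (n : nat) : (INR n ^ n <= 3 ^ n * INR (Factorial.fact n))%R.
Proof.
  induction n as [|n IH]; [simpl; lra|].
  assert (B : (INR (S n) ^ n <= 3 * INR n ^ n)%R).
  { destruct n as [|n]; [simpl; lra|].
    set (x := INR (S n)) in *. assert (X : (0 < x)%R) by apply lt_0_INR, Nat.lt_0_succ.
    replace (INR (S (S n))) with (x * (1 + / x))%R.
    2:{ rewrite (S_INR (S n)). fold x. field. lra. }
    rewrite Rpow_mult_distr, Rmult_comm. apply Rmult_le_compat_r; [apply pow_le; lra|].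
    apply Rle_trans with (exp (/ x) ^ S n)%R.
    - apply pow_incr. split; [|apply exp_ineq1_le]. pose proof (Rinv_0_lt_compat x X). lra.
    - rewrite exp_pow_INR. fold x. rewrite Rinv_r by lra. apply exp_le_3. }
  rewrite fact_simpl, mult_INR. change (INR (S n) ^ S n)%R with (INR (S n) * INR (S n) ^ n)%R.
  change (3 ^ S n)%R with (3 * 3 ^ n)%R.
  assert (P : (0 < INR (S n))%R) by apply lt_0_INR, Nat.lt_0_succ.
  replace (3 * 3 ^ n * (INR (S n) * INR (Factorial.fact n)))%R
    with (INR (S n) * (3 * (3 ^ n * INR (Factorial.fact n))))%R by ring.
  apply Rmult_le_compat_l; lra.
Qed.

Lemma Cmod_RtoC_pos (x : R) : (0 <= x)%R -> Cmod (RtoC x) = x.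
Proof. intros H. rewrite Cmod_R. now apply Rabs_pos_eq. Qed.

Lemma entire_expD_term_bound (f : C -> C) (s : C) (N : nat) : entire f -> (0 < N)%nat ->
  exists M, (0 <= M)%R /\ forall k, (Cmod (expD_term N f s k) <= M * (/ 2) ^ k)%R.
Proof.
  intros Hf HN. apply lt_0_INR in HN. set (x := INR N) in *.
  (* With radius 12 N and steps of 12 N / k, the term is at most M k^k / (6^k k!), and k^k <= 3^k k!
     leaves M / 2^k. *)
  destruct (continuous_bounded_disc f s (12 * x) (entire_Ccont_at f Hf)) as [M [M0 HM]]; [lra|].
  exists M. split; [exact M0|]. intros k.
  assert (F : (0 < INR (Factorial.fact k))%R) by apply INR_fact_lt_0.
  unfold expD_term. fold x.
  rewrite Cmod_mult, Cmod_div, Cmod_pow, !Cmod_RtoC_pos by (try lra; intros Q; apply RtoC_inj in Q; lra).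
  (* The step 12 N / k makes sense only for k > 0; the term for k = 0 is [f s] itself. *)
  destruct k as [|k].
  { simpl. rewrite Rmult_1_r, Rdiv_1_r, Rmult_1_l. apply HM.
    replace (s - s) with (RtoC 0) by ring. rewrite Cmod_0. lra. }
  set (n := S k) in *. assert (X : (0 < INR n)%R) by apply lt_0_INR, Nat.lt_0_succ.
  assert (B : (Cmod (C_derive_n f n s) <= M * (2 / (12 * x / INR n)) ^ n)%R).
  { apply (Cauchy_estimate_n f s (12 * x)); auto.
    - apply Rdiv_lt_0_compat; lra.
    - replace (s - s) with (RtoC 0) by ring. rewrite Cmod_0. right. field. lra. }
  replace (2 / (12 * x / INR n))%R with (INR n * / (6 * x))%R in B by (field; lra).
  rewrite Rpow_mult_distr in B.
  apply Rle_trans with (x ^ n / INR (Factorial.fact n) * (M * (INR n ^ n * (/ (6 * x)) ^ n)))%R.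
  { apply Rmult_le_compat_l; [|exact B]. apply Rlt_le, Rdiv_lt_0_compat; [now apply pow_lt|exact F]. }
  assert (Q : (x ^ n * (/ (6 * x)) ^ n * 3 ^ n = (/ 2) ^ n)%R).
  { rewrite <- !Rpow_mult_distr. f_equal. field. lra. }
  rewrite <- Q.
  apply Rmult_le_reg_r with (INR (Factorial.fact n)); [exact F|].
  replace (x ^ n / INR (Factorial.fact n) * (M * (INR n ^ n * (/ (6 * x)) ^ n)) * INR (Factorial.fact n))%R
    with (M * (x ^ n * (/ (6 * x)) ^ n) * INR n ^ n)%R by (field; lra).
  replace (M * (x ^ n * (/ (6 * x)) ^ n * 3 ^ n) * INR (Factorial.fact n))%R
    with (M * (x ^ n * (/ (6 * x)) ^ n) * (3 ^ n * INR (Factorial.fact n)))%R by ring.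
  apply Rmult_le_compat_l; [|apply pow_self_le_fact].
  apply Rmult_le_pos; [exact M0|]. apply Rmult_le_pos; apply pow_le; [lra|].
  left. apply Rinv_0_lt_compat. lra.
Qed.

Lemma Cminus_neq_0 (z c : C) : z <> c -> z - c <> 0.
Proof. intros H E. apply H. replace z with ((z - c) + c) by ring. rewrite E. ring. Qed.

Lemma Cdiff_at_inv_sub (c z : C) : z <> c ->
  Cdiff_at (fun w => / (w - c)) z (- (/ (z - c) * / (z - c))).
Proof.
  intros H. assert (N := Cminus_neq_0 _ _ H).
  eapply Cdiff_at_ext; cycle 2.
  - apply (Cdiff_at_comp Cinv (fun w => w - c)); [apply Cdiff_at_inv, N|].
    apply Cdiff_at_minus; [apply Cdiff_at_id|apply Cdiff_at_const].
  - reflexivity.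
  - cbn beta. field. exact N.
Qed.

(** Divided by z - c, an entire [h] is h(c) / (z - c) plus an entire function. At [c] itself, the
    derivative of the quotient is h''(c) / 2, which exists by [entire_derivative]. *)
Lemma removable_quotient (h : C -> C) (c : C) : entire h ->
  exists q, entire q /\ forall z, z <> c -> q z = (h z - h c) / (z - c).
Proof.
  intros Hh. set (h' := C_derive h).
  assert (D : forall z, Cdiff_at h z (h' z)) by (intros z; now apply entire_C_derive).
  set (q := fun z => if Ceq_dec z c then h' c else (h z - h c) / (z - c)).
  assert (Hq : forall z, z <> c -> q z = (h z - h c) / (z - c)).
  { intros z Hz. unfold q. now destruct (Ceq_dec z c). }
  exists q. split; [|exact Hq]. intros z. destruct (Ceq_dec z c) as [->|Hz].
  - destruct (entire_derivative h h' D c) as [b Hb].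
    exists (b / 2). intros eps Heps.
    destruct (Hb (eps / 2)%R ltac:(lra)) as [del [Hd H]].
    exists del. split; [exact Hd|]. intros w Hw.
    destruct (Ceq_dec w 0) as [->|W].
    { replace (c + 0) with c by ring. replace (q c - q c - b / 2 * 0) with (RtoC 0) by ring.
      rewrite Cmod_0. lra. }
    assert (W' : c + w <> c).
    { intros Q. apply W. replace w with ((c + w) - c) by ring. rewrite Q. ring. }
    rewrite Hq by exact W'. unfold q at 1. destruct (Ceq_dec c c) as [_|Q]; [|now contradict Q].
    (* [h] minus its Taylor polynomial of degree 2 at [c], up to a constant. Its derivative is the
       first-order remainder of [h'], so its increment is at most [eps * Cmod w ^ 2]; the tolerance
       [eps / 2] offsets the 2 in [Cmean_value]. *)
    set (g := fun x => h x - (h' c * x + b / 2 * ((x - c) * (x - c)))).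
    assert (G : (Cmod (g (c + w)%C - g c)%C <= 2 * (eps / 2 * Cmod w) * Cmod w)%R).
    { apply (Cmean_value g (fun x => h' x - h' c - b * (x - c))).
      intros t Ht. split.
      - unfold g. eapply Cdiff_at_ext; cycle 2.
        + apply Cdiff_at_minus; [apply D|]. apply Cdiff_at_plus.
          * apply Cdiff_at_mult; [apply Cdiff_at_const|apply Cdiff_at_id].
          * apply Cdiff_at_mult; [apply Cdiff_at_const|].
            apply Cdiff_at_mult; (apply Cdiff_at_minus; [apply Cdiff_at_id|apply Cdiff_at_const]).
        + reflexivity.
        + cbn beta. field.
      - replace (c + RtoC t * w - c) with (RtoC t * w) by ring.
        assert (Tw : (Cmod (RtoC t * w) <= Cmod w)%R).
        { rewrite Cmod_mult, Cmod_RtoC_pos by lra. pose proof (Cmod_ge_0 w). nra. }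
        eapply Rle_trans; [apply H; lra|]. apply Rmult_le_compat_l; lra. }
    replace ((h (c + w) - h c) / (c + w - c) - h' c - b / 2 * w) with ((g (c + w) - g c) * / w).
    2:{ replace (c + w - c) with w by ring. unfold g. field. exact W. }
    apply Cmod_gt_0 in W as W0.
    rewrite Cmod_mult, Cmod_inv by exact W.
    apply Rmult_le_reg_r with (Cmod w); [exact W0|].
    rewrite Rmult_assoc, Rinv_l, Rmult_1_r by lra. lra.
  - eexists. eapply (Cdiff_at_ext_loc (fun w => (h w - h c) * / (w - c)) q z _ _ (Cmod (z - c))).
    + apply Cmod_gt_0, Cminus_neq_0, Hz.
    + intros w Hw. rewrite Hq; [reflexivity|]. intros ->. rewrite Cmod_minus_sym in Hw. lra.
    + reflexivity.
    + apply Cdiff_at_mult; [|now apply Cdiff_at_inv_sub].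
      apply Cdiff_at_minus; [apply D|apply Cdiff_at_const].
Qed.

Lemma Cdiff_at_inv_sub_pow (c z : C) (k : nat) : z <> c ->
  Cdiff_at (fun w => (/ (w - c)) ^ S k) z (- RtoC (INR (S k)) * (/ (z - c)) ^ S (S k)).
Proof.
  intros H. induction k as [|k IH].
  - eapply Cdiff_at_ext; cycle 2; [exact (Cdiff_at_inv_sub c z H)| |].
    + intros w. simpl. ring.
    + simpl. ring.
  - eapply Cdiff_at_ext; cycle 2.
    + apply Cdiff_at_mult; [now apply (Cdiff_at_inv_sub c)|exact IH].
    + reflexivity.
    + cbn beta. rewrite (S_INR (S k)), RtoC_plus. simpl Cpow. ring.
Qed.

(** The k-th derivative of A / (z - c). *)
Definition pole_deriv (A c : C) (k : nat) (z : C) : C :=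
  A * ((-(1)) ^ k * RtoC (INR (Factorial.fact k))) * (/ (z - c)) ^ S k.

(** The disc of radius |z - c| about [z] omits [c], so the induction hypothesis holds near [z] and
    can be differentiated; the value [f c] never enters. *)
Lemma C_derive_n_pole (f q : C -> C) (A c : C) : entire q ->
  (forall z, z <> c -> f z = A / (z - c) + q z) ->
  forall k z, z <> c -> C_derive_n f k z = pole_deriv A c k z + C_derive_n q k z.
Proof.
  intros Hq Hf k. induction k as [|k IH]; intros z Hz.
  - simpl. rewrite Hf by exact Hz. unfold pole_deriv. simpl. unfold Cdiv. ring.
  - simpl C_derive_n. apply Cdiff_at_C_derive.
    eapply (Cdiff_at_ext_loc (fun w => pole_deriv A c k w + C_derive_n q k w) _ z _ _ (Cmod (z - c))).
    + apply Cmod_gt_0, Cminus_neq_0, Hz.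
    + intros w Hw. symmetry. apply IH. intros ->. rewrite Cmod_minus_sym in Hw. lra.
    + reflexivity.
    + apply Cdiff_at_plus.
      * eapply Cdiff_at_ext; cycle 2.
        -- apply Cdiff_at_mult; [apply Cdiff_at_const|now apply (Cdiff_at_inv_sub_pow c)].
        -- intros w. unfold pole_deriv. reflexivity.
        -- unfold pole_deriv. rewrite fact_simpl, mult_INR, RtoC_mult. simpl Cpow. ring.
      * apply entire_C_derive, entire_C_derive_n, Hq.
Qed.

Lemma expD_term_pole_diverges (f q : C -> C) (A c s : C) (N : nat) : entire q -> A <> 0 -> s <> c ->
  (forall z, z <> c -> f z = A / (z - c) + q z) ->
  (0 < N)%nat -> (Cmod (s - c) <= INR N)%R -> ~ ex_series (expD_term N f s).
Proof.
  intros Hq HA Hs Hf HN HsN Hser.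
  assert (N0 := Cminus_neq_0 _ _ Hs). assert (P0 := proj1 (Cmod_gt_0 _) N0).
  assert (A0 := proj1 (Cmod_gt_0 _) HA).
  destruct (entire_expD_term_bound q s N Hq HN) as [M [M0 HM]].
  set (e := (Cmod A / Cmod (s - c))%R).
  assert (He : (0 < e)%R) by now apply Rdiv_lt_0_compat.
  (* The polar part has modulus e (N / |s - c|)^k, at least [e] because N >= |s - c|; the entire
     part takes away at most M / 2^k. *)
  assert (Low : forall k, (e <= Cmod (expD_term N f s k) + M * (/ 2) ^ k)%R).
  { intros k.
    assert (F : RtoC (INR (Factorial.fact k)) <> 0).
    { intros Q. apply RtoC_inj in Q. pose proof (INR_fact_lt_0 k). lra. }
    assert (E : expD_term N f s k - expD_term N q s k
      = A * / (s - c) * ((-(1)) ^ k * (RtoC (INR N) ^ k * (/ (s - c)) ^ k))).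
    { unfold expD_term. rewrite (C_derive_n_pole f q A c) by auto. unfold pole_deriv. simpl Cpow.
      field. auto. }
    apply Rle_trans with (Cmod (expD_term N f s k - expD_term N q s k)).
    - rewrite E, !Cmod_mult, !Cmod_pow, Cmod_m1, pow1, Cmod_inv by exact N0.
      rewrite Cmod_RtoC_pos by apply pos_INR.
      rewrite Rmult_1_l, <- Rpow_mult_distr. fold (Cmod A / Cmod (s - c))%R. fold e.
      rewrite <- (Rmult_1_r e) at 1. apply Rmult_le_compat_l; [lra|].
      apply pow_R1_Rle. apply Rmult_le_reg_r with (Cmod (s - c)); [exact P0|].
      rewrite Rmult_assoc, Rinv_l, Rmult_1_l, Rmult_1_r by lra. exact HsN.
    - eapply Rle_trans; [apply Cmod_triangle_minus|]. specialize (HM k). lra. }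
  assert (Hterm : exists n1, forall k, (n1 <= k)%nat -> (Cmod (expD_term N f s k) < e / 2)%R).
  { destruct (Cauchy_ex_series _ Hser (mkposreal (e / 2) ltac:(lra))) as [n1 Hn1].
    exists n1. intros k Hk. specialize (Hn1 k k Hk Hk). rewrite sum_n_n in Hn1. exact Hn1. }
  destruct Hterm as [n1 Hn1].
  destruct (pow_lt_1_zero (/ 2) ltac:(rewrite Rabs_pos_eq; lra) (e / 2 / (M + 1))%R) as [n2 Hn2].
  { apply Rdiv_lt_0_compat; lra. }
  set (k := Nat.max n1 n2).
  specialize (Hn1 k (Nat.le_max_l _ _)). specialize (Hn2 k (Nat.le_max_r _ _)). specialize (Low k).
  assert (Q : (0 < (/ 2) ^ k)%R) by (apply pow_lt; lra).
  rewrite Rabs_pos_eq in Hn2 by lra.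
  apply Rmult_lt_compat_r with (r := (M + 1)%R) in Hn2; [|lra].
  unfold Rdiv at 1 in Hn2. rewrite Rmult_assoc, Rinv_l, Rmult_1_r in Hn2 by lra.
  nra.
Qed.

(** * The Hurwitz zeta function *)

Lemma entire_Rcpow_opp (a : R) : entire (fun z => Rcpow a (- z)).
Proof.
  intros z. eexists. eapply Cdiff_at_ext; cycle 2.
  - apply (Cdiff_at_comp Cexp (fun w => 0 + (- RtoC (ln a)) * w)); [apply Cdiff_at_Cexp|apply Cdiff_at_affine].
  - intros w. unfold Rcpow. f_equal. ring.
  - reflexivity.
Qed.

Lemma holomorphic_near_Cdiff_at (f : C -> C) (z : C) :
  holomorphic_near f z -> exists l, Cdiff_at f z l.
Proof.
  intros H. apply ex_derive_Cdiff_at.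
  exact (locally_singleton (T := C_UniformSpace) z _ H).
Qed.

(** [Z 1] is arbitrary, so (z - 1) f(z) has to be given the value [g 1] at 1. Near 1 it then equals
    g(z) - (z - 1) a^(-z), hence it is entire, and [removable_quotient] splits off the pole with
    residue [g 1]. *)
Lemma hurwitz_pole_decomposition (a : R) (Z f : C -> C) : is_hurwitz_zeta a Z ->
  (forall s : C, f s = Z s - Rcpow a (- s)) ->
  exists (A : C) (q : C -> C), A <> 0 /\ entire q /\ forall z : C, z <> 1 -> f z = A / (z - 1) + q z.
Proof.
  intros [_ Hhol [g [Hg [Hg1 HZ]]]] Hf.
  set (h := fun z => if Ceq_dec z 1 then g 1 else (z - 1) * f z).
  assert (Hh : forall z : C, z <> 1 -> h z = (z - 1) * f z).
  { intros z Hz. unfold h. destruct (Ceq_dec z 1); [contradiction|reflexivity]. }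
  assert (Hh1 : h 1 = g 1).
  { unfold h. destruct (Ceq_dec 1 1) as [_|Q]; [reflexivity|now contradict Q]. }
  assert (Eh : entire h).
  { intros z. destruct (entire_Rcpow_opp a z) as [m Hm]. destruct (Ceq_dec z 1) as [->|Hz].
    - apply locally_C_Cmod in HZ. destruct HZ as [r [Hr HZ]].
      destruct (holomorphic_near_Cdiff_at _ _ Hg) as [l Hl].
      eexists. eapply (Cdiff_at_ext_loc (fun w => g w - (w - 1) * Rcpow a (- w)) h 1 _ _ r Hr).
      + intros w Hw. destruct (Ceq_dec w 1) as [->|W]; [rewrite Hh1; ring|].
        rewrite Hh, Hf, (HZ w Hw W) by exact W. field. now apply Cminus_neq_0.
      + reflexivity.
      + apply Cdiff_at_minus; [exact Hl|]. apply Cdiff_at_mult; [|exact Hm].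
        apply Cdiff_at_minus; [apply Cdiff_at_id|apply Cdiff_at_const].
    - destruct (holomorphic_near_Cdiff_at _ _ (Hhol z Hz)) as [l Hl].
      eexists. eapply (Cdiff_at_ext_loc (fun w => (w - 1) * (Z w - Rcpow a (- w))) h z _ _ (Cmod (z - 1))).
      + apply Cmod_gt_0, Cminus_neq_0, Hz.
      + intros w Hw. rewrite Hh, Hf; [reflexivity|]. intros ->. rewrite Cmod_minus_sym in Hw. lra.
      + reflexivity.
      + apply Cdiff_at_mult; [|apply Cdiff_at_minus; [exact Hl|exact Hm]].
        apply Cdiff_at_minus; [apply Cdiff_at_id|apply Cdiff_at_const]. }
  destruct (removable_quotient h 1 Eh) as [q [Eq Hq]].
  exists (h 1), q. split; [now rewrite Hh1|]. split; [exact Eq|].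
  intros z Hz. rewrite Hq, (Hh z) by exact Hz. field. now apply Cminus_neq_0.
Qed.

(** Otherwise (w - c) (f(w) - q(w)) would be continuous at [c] with value 0 there, whereas it equals
    [A] at every other point. *)
Lemma pole_not_Cdiff_at (f q : C -> C) (A c l : C) : A <> 0 -> entire q ->
  (forall z, z <> c -> f z = A / (z - c) + q z) -> ~ Cdiff_at f c l.
Proof.
  intros HA Hq Hf Hl. destruct (Hq c) as [m Hm].
  assert (A0 := proj1 (Cmod_gt_0 _) HA).
  assert (D : Cdiff_at (fun w => (w - c) * (f w - q w)) c ((1 - 0) * (f c - q c) + (c - c) * (l - m))).
  { apply (Cdiff_at_mult (fun w => w - c) (fun w => f w - q w)); [|now apply Cdiff_at_minus].
    apply Cdiff_at_minus; [apply Cdiff_at_id|apply Cdiff_at_const]. }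
  destruct (Cdiff_at_continuous _ _ _ D _ A0) as [del [Hd H]].
  specialize (H (c + RtoC (del / 2))).
  replace (c + RtoC (del / 2) - c) with (RtoC (del / 2)) in H by ring.
  rewrite Cmod_RtoC_pos in H by lra. specialize (H ltac:(lra)).
  assert (N : RtoC (del / 2) <> 0) by (intros Q; apply RtoC_inj in Q; lra).
  rewrite Hf in H.
  - replace (c + RtoC (del / 2) - c) with (RtoC (del / 2)) in H by ring.
    replace (RtoC (del / 2) * (A / RtoC (del / 2) + q (c + RtoC (del / 2)) - q (c + RtoC (del / 2)))
      - (c - c) * (f c - q c)) with A in H by (field; exact N).
    lra.
  - intros Q. apply N. replace (RtoC (del / 2)) with (c + RtoC (del / 2) - c) by ring.
    rewrite Q. ring.
Qed.

Theorem theorem1 (a : R) (ha : (0 < a <= 1)%R)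
    (Z : C -> C) (hZ : is_hurwitz_zeta a Z) (f : C -> C)
    (hf : forall s : C, f s = Z s - Rcpow a (- s)) :
  forall s : C, exists N : nat,
    ((s = 1 /\ ~ holomorphic_near f s) \/
     (s <> 1 /\ holomorphic_near f s /\ ~ ex_series (expD_term N f s))) /\
    ~ (exists v : C, is_T_term f s N v) /\
    (forall M : nat, (N <= M)%nat -> ~ exists v : C, is_T_partial_sum f s M v).
Proof.
  destruct (hurwitz_pole_decomposition a Z f hZ hf) as [A [q [HA [Eq Hq]]]].
  intros s.
  assert (Hred : exists N : nat, (s = 1 /\ ~ holomorphic_near f s) \/
     (s <> 1 /\ holomorphic_near f s /\ ~ ex_series (expD_term N f s))).
  { destruct (Ceq_dec s 1) as [->|Hs].
    (* At the pole already the term of index 0 is undefined, since [is_expD] requires holomorphy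
       near [s]. *)
    - exists 0%nat. left. split; [reflexivity|]. intros H.
      destruct (holomorphic_near_Cdiff_at _ _ H) as [l Hl].
      exact (pole_not_Cdiff_at f q A 1 l HA Eq Hq Hl).
    - destruct (INR_unbounded (Cmod (s - 1))) as [N HN]. exists N. right.
      split; [exact Hs|]. split.
      + apply locally_C_Cmod. exists (Cmod (s - 1)).
        split; [apply Cmod_gt_0, Cminus_neq_0, Hs|]. intros w Hw.
        assert (W : w <> 1) by (intros ->; rewrite Cmod_minus_sym in Hw; lra).
        apply ex_derive_Cdiff_at.
        destruct (holomorphic_near_Cdiff_at _ _ (hurwitz_holomorphic a Z hZ w W)) as [l Hl].
        destruct (entire_Rcpow_opp a w) as [m Hm].
        exists (l - m). eapply Cdiff_at_ext; [|reflexivity|exact (Cdiff_at_minus _ _ _ _ _ Hl Hm)].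
        intros x. now rewrite hf.
      + apply (expD_term_pole_diverges f q A 1); auto; [|lra].
        apply INR_lt. simpl. pose proof (Cmod_ge_0 (s - 1)). lra. }
  destruct Hred as [N HN]. exists N. split; [exact HN|].
  assert (HT : ~ (exists v : C, is_T_term f s N v)).
  { intros [v [e [[H1 H2] _]]]. destruct HN as [[_ HN]|[_ [_ HN]]]; [auto|].
    apply HN. now exists e. }
  (* A partial sum up to [M >= N] would include a value for the term of index [N]. *)
  split; [exact HT|]. intros M HM [v [t [Ht _]]]. apply HT. exists (t N). now apply Ht.
Qed.
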